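(* Assume in addition $J\in L^2(\mathbb{R}^N)$ and let $h\in L^1(\mathbb{R}^N\setminus\Omega)$. The stationary problem $$0=\int_\Omega J(x-y)(\varphi(y)-\varphi(x))\,dy+\int_{\mathbb{R}^N\setminus\Omega}J(x-y)h(y)\,dy,\qquad x\in\Omega,$$ has a solution $\varphi\in L^2(\Omega)$ if and only if $$\int_\Omega\int_{\mathbb{R}^N\setminus\Omega}J(x-y)h(y)\,dy\,dx=0.$$ Moreover, any two solutions differ by an additive constant.
   Context: Standing assumptions: $\Omega\subset\mathbb{R}^N$ bounded, connected, smooth; $J\ge0$ symmetric, $\int J=1$, $J>0$ on $B(0,d)$, $J=0$ outside $B(0,d)$. *)

(* Defs.v *)
From mathcomp Require Import all_boot all_algebra all_classical all_reals all_analysis.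
Import GRing.Theory Num.Theory.
Set Implicit Arguments. Unset Strict Implicit. Unset Printing Implicit Defensive.
Local Open Scope ring_scope.
Local Open Scope classical_set_scope.

Definition dispR (R : realType) : measure_display :=
  (R.-ocitv.-measurable).-sigma%mdisp.

Fixpoint Rn_disp (R : realType) (n : nat) : measure_display :=
  match n with 0 => dispR R | S n => (Rn_disp R n, dispR R).-prod%mdisp end.

(* Rn R n  represents  R^(n+1) *)
Fixpoint Rn (R : realType) (n : nat) : measurableType (Rn_disp R n) :=
  match n return measurableType (Rn_disp R n) with
  | 0 => measurableTypeR R
  | S n => (Rn R n * measurableTypeR R)%type
  end.

Fixpoint lebn (R : realType) (n : nat) : {measure set (Rn R n) -> \bar R} :=
  match n return {measure set (Rn R n) -> \bar R} with
  | 0 => @lebesgue_measure R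
  | S n => (lebn R n \x lebesgue_measure)%E
  end.

Fixpoint vsub (R : realType) (n : nat) : Rn R n -> Rn R n -> Rn R n :=
  match n return Rn R n -> Rn R n -> Rn R n with
  | 0 => fun x y => ((x : R) - (y : R) : R)
  | S n => fun x y => (vsub x.1 y.1, ((x.2 : R) - (y.2 : R) : R))
  end.

Fixpoint vneg (R : realType) (n : nat) : Rn R n -> Rn R n :=
  match n return Rn R n -> Rn R n with
  | 0 => fun x => (- (x : R) : R)
  | S n => fun x => (vneg x.1, (- (x.2 : R) : R))
  end.

Fixpoint sqnorm (R : realType) (n : nat) : Rn R n -> R :=
  match n return Rn R n -> R with
  | 0 => fun x => (x : R) ^+ 2
  | S n => fun x => sqnorm x.1 + (x.2 : R) ^+ 2
  end.

Definition enorm (R : realType) (n : nat) (x : Rn R n) : R := Num.sqrt (sqnorm x).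

Definition eopen (R : realType) (n : nat) (U : set (Rn R n)) : Prop :=
  forall x, U x -> exists2 r : R, 0 < r & forall y, enorm (vsub y x) < r -> U y.

Definition ebounded (R : realType) (n : nat) (U : set (Rn R n)) : Prop :=
  exists M : R, forall x, U x -> enorm x <= M.

Definition econnected (R : realType) (n : nat) (U : set (Rn R n)) : Prop :=
  forall A B : set (Rn R n), eopen A -> eopen B ->
    U `<=` A `|` B -> U `&` A `&` B = set0 ->
    U `&` A = set0 \/ U `&` B = set0.

Definition kernel_assumptions (R : realType) (n : nat) (J : Rn R n -> R) (d : R) : Prop :=
  [/\ 0 < d,
      measurable_fun setT J,
      (forall z, 0 <= J z) &
      (forall z, J (vneg z) = J z)] /\
  [/\ (\int[lebn R n]_z (J z)%:E = 1)%E,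
      (forall z, enorm z < d -> 0 < J z) &
      (forall z, d <= enorm z -> J z = 0)].

Definition stationary_solution (R : realType) (n : nat) (J : Rn R n -> R)
    (Omega : set (Rn R n)) (h phi : Rn R n -> R) : Prop :=
  [/\ measurable_fun Omega phi,
      (lebn R n).-integrable Omega (fun x => (phi x ^+ 2)%:E) &
      {ae lebn R n, forall x, Omega x ->
        [/\ (lebn R n).-integrable Omega
                (fun y => (J (vsub x y) * (phi y - phi x))%:E),
            (lebn R n).-integrable (~` Omega)
                (fun y => (J (vsub x y) * h y)%:E) &
            ((\int[lebn R n]_(y in Omega) (J (vsub x y) * (phi y - phi x))%:E)
             + (\int[lebn R n]_(y in ~` Omega) (J (vsub x y) * h y)%:E) = 0)%E]}].

(* Main.v *)
Require Import Defs.
From HB Require Import structures.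
From mathcomp Require Import all_boot all_order all_algebra all_classical all_reals all_analysis.
From mathcomp Require Import measurable_realfun ring lra.
Import Order.TTheory GRing.Theory Num.Theory.
Set Implicit Arguments. Unset Strict Implicit. Unset Printing Implicit Defensive.
Local Open Scope ring_scope.
Local Open Scope classical_set_scope.
Import numFieldNormedType.Exports.

(* The operator L f(x) = int_Omega J(x - y) (f(x) - f(y)) dy is symmetric on
   L^2(Omega) and satisfies 2 <L f, f> = E(f) and ||L f||^2 <= E(f), where
   E(f) = int int J(x - y) (f(x) - f(y))^2.  A Poincare inequality
   ||f||^2 <= C E(f) for mean-zero f turns the Richardson iteration
   f |-> f - L f / 2 into a strict contraction of the squared norm, so that
   L phi = H is solved by a geometrically convergent series as soon as H has
   mean zero; it also forces E(f) = 0, hence f constant, on the kernel of L.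
   Necessity of the mean-zero condition is the antisymmetry of the integrand.
   The Poincare inequality is obtained pointwise.  If x and y are at distance
   well below the range of J, then (f(x) - f(y))^2 is controlled by averaging
   over the z for which both J(x - z) and J(y - z) exceed a threshold;
   connectedness propagates the estimate along overlapping boxes and
   boundedness makes the constant uniform. *)

(** [J] is only measurable, so its positivity on a ball gives no positive lower bound on smaller
    balls. What remains is that the sets where [J] falls below a threshold have small measure,
    uniformly under translation. The overlap of two kernels is thus a statement about measures,
    which is why points are compared by averaging over sets of positive measure. The threshold
    depends on how much of [Omega] surrounds a given point; uniformity is recovered at the end from
    finitely many classes of points, with one constant for each pair of classes. The limit of the
    iteration is built pointwise from an integrable majorant, so that dominated convergence passes
    the equation itself to the limit at almost every [x]. The operator theory is carried out on the
    whole type with the finite measure [mfrestr], Lebesgue measure restricted to [Omega]. *)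

Section averaging.
Context d (T : measurableType d) (R : realType) (mu : {measure set T -> \bar R}).

Lemma integrable_ge0 (f : T -> R) : measurable_fun setT f ->
  (forall x, 0 <= f x) -> (\int[mu]_x (f x)%:E < +oo)%E ->
  mu.-integrable setT (EFin \o f).
Proof.
move=> mf f0 foo; apply/integrableP; split; first exact/measurable_EFinP.
by under eq_integral => x _ do rewrite /= ger0_norm//.
Qed.

Lemma cauchy_schwarz_weight (rho g : T -> R) (c : R) :
  measurable_fun setT rho -> measurable_fun setT g ->
  (forall x, 0 <= rho x) -> 0 < c ->
  (\int[mu]_x (rho x)%:E <= c%:E)%E ->
  (\int[mu]_x (rho x * g x ^+ 2)%:E < +oo)%E ->
  mu.-integrable setT (EFin \o (fun x => rho x * g x)) /\
  (((\int[mu]_x (rho x * g x)) ^+ 2)%:E <=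
     c%:E * \int[mu]_x (rho x * g x ^+ 2)%:E)%E.
Proof.
move=> mr mg r0 c0 rc rgoo.
have ir : mu.-integrable setT (EFin \o rho).
  by apply: integrable_ge0 => //; apply: le_lt_trans rc _; rewrite ltry.
have mrg : measurable_fun setT (fun x => rho x * g x) by exact: measurable_funM.
have irg2 : mu.-integrable setT (EFin \o (fun x => rho x * g x ^+ 2)).
  apply: integrable_ge0 => //.
    by apply: measurable_funM => //; exact: measurable_funX.
  by move=> x; rewrite mulr_ge0// sqr_ge0.
have irg : mu.-integrable setT (EFin \o (fun x => rho x * g x)).
  apply: (le_integrable measurableT _ _ (integrableD measurableT ir irg2)).
    exact/measurable_EFinP.
  move=> x _; rewrite [X in (X <= _)%E]/= -[X in (_ <= X)%E]/(`|rho x + rho x * g x ^+ 2|%:E) lee_fin.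
  have := r0 x; move: (rho x) (g x) => a b a0.
  rewrite normrM (ger0_norm a0) [leRHS]ger0_norm; last first.
    by rewrite addr_ge0// mulr_ge0// sqr_ge0.
  have : `|b| <= 1 + b ^+ 2.
    by rewrite -real_normK ?num_real//; have := normr_ge0 b; nra.
  by move=> /(ler_wpM2l a0); rewrite mulrDr mulr1.
split=> //.
set m := (\int[mu]_x (rho x * g x))%R.
(* The bound is the nonnegativity of the integral of rho (g - m / c)^2. *)
pose t := m / c.
have -> : (\int[mu]_x (rho x * g x ^+ 2)%:E)%E =
    (\int[mu]_x (rho x * g x ^+ 2))%R%:E.
  by rewrite fineK//; exact: integrable_fin_num.
rewrite -EFinM lee_fin.
set S := (\int[mu]_x (rho x * g x ^+ 2))%R.
have ac : (\int[mu]_x rho x)%R <= c.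
  by rewrite -lee_fin fineK//; exact: integrable_fin_num.
have : 0 <= (\int[mu]_x (rho x * (g x - t) ^+ 2))%R.
  by apply: Rintegral_ge0 => x _; rewrite mulr_ge0// sqr_ge0.
have -> : (\int[mu]_x (rho x * (g x - t) ^+ 2))%R =
    S - 2 * t * m + t ^+ 2 * (\int[mu]_x rho x)%R.
  under eq_Rintegral => x _.
    rewrite (_ : _ * _ = rho x * g x ^+ 2 - (2 * t) * (rho x * g x) + t ^+ 2 * rho x); last by ring.
    over.
  have i1 : mu.-integrable setT (EFin \o (fun x => 2 * t * (rho x * g x))).
    exact: (integrableZl measurableT _ irg).
  have i2 : mu.-integrable setT (EFin \o (fun x => t ^+ 2 * rho x)).
    exact: (integrableZl measurableT _ ir).
  rewrite RintegralD//; last exact: (integrableB measurableT irg2 i1).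
  by rewrite RintegralB// !RintegralZl.
move: (\int[mu]_x rho x)%R ac => a ac.
have tc : m = t * c by rewrite /t divfK// gt_eqF.
(* [H] gives [S >= t ^+ 2 * (2 * c - a)], hence [S >= t ^+ 2 * c] since [a <= c]. Using the bound
   [c] instead of the mass [a] avoids dividing by a mass that may vanish. *)
rewrite tc => H.
have : 0 <= t ^+ 2 by exact: sqr_ge0.
nra.
Qed.

(** A Chebyshev-type bound: [g] is at least [t - a] on [S], so its integral is at least
    [(t - a) * m]. The value [a] may be infinite because it will stand for energy densities. *)
Lemma averaging (S : set T) (g : T -> \bar R) (a : \bar R) (t m : R) :
  measurable S -> measurable_fun setT g -> (forall z, 0 <= g z)%E ->
  (0 <= a)%E -> 0 < m -> (m%:E <= mu S)%E ->
  (forall z, S z -> (t%:E <= a + g z)%E) ->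
  (t%:E <= a + m^-1%:E * \int[mu]_z g z)%E.
Proof.
move=> mS mg g0 a0 m0 mSm H.
have I0 : (0 <= \int[mu]_z g z)%E by exact: integral_ge0.
have mI0 : (0 <= m^-1%:E * \int[mu]_z g z)%E.
  by rewrite mule_ge0// lee_fin invr_ge0 ltW.
case: a a0 H => [a||] // a0 H; last first.
  by rewrite addye ?leey// -ltNye; exact: lt_le_trans mI0.
case: (leP t a) => [ta|a_t].
  by apply: (@le_trans _ _ a%:E); rewrite ?lee_fin// leeDl.
have s0 : 0 < t - a by rewrite subr_gt0.
have H1 : (((t - a) * m)%:E <= \int[mu]_z g z)%E.
  apply: (@le_trans _ _ (\int[mu]_(z in S) g z)%E); last first.
    by apply: ge0_subset_integral.
  apply: (@le_trans _ _ (\int[mu]_(z in S) cst (t - a)%:E z)%E); last first.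
    apply: ge0_le_integral => //.
    - by move=> z _; rewrite lee_fin ltW.
    - exact: measurable_funTS.
    - by move=> z Sz; rewrite EFinB leeBlDl// H.
  by rewrite integral_cst// EFinM; apply: lee_wpmul2l => //; rewrite lee_fin ltW.
rewrite -leeBlDl// -EFinB.
apply: (@le_trans _ _ (m^-1%:E * ((t - a) * m)%:E)%E).
  by rewrite -EFinM mulrCA mulVf ?mulr1// gt_eqF.
by apply: lee_wpmul2l => //; rewrite lee_fin invr_ge0 ltW.
Qed.

End averaging.

(** * Elementary square bounds and square-integrable functions *)

Lemma sqrD_le (R : realType) (a b : R) : (a + b) ^+ 2 <= 2 * a ^+ 2 + 2 * b ^+ 2.
Proof. by have := sqr_ge0 (a - b); nra. Qed.

Lemma sqrB_le (R : realType) (a b : R) : (a - b) ^+ 2 <= 2 * a ^+ 2 + 2 * b ^+ 2.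
Proof. by have := sqrD_le a (- b); rewrite sqrrN. Qed.

Section square_integrable.
Context d (T : measurableType d) (R : realType) (mu : {measure set T -> \bar R}).
Implicit Types f g : T -> R.

Lemma square_integrableD f g : measurable_fun setT f -> measurable_fun setT g ->
  mu.-integrable setT (fun x => (f x ^+ 2)%:E) ->
  mu.-integrable setT (fun x => (g x ^+ 2)%:E) ->
  mu.-integrable setT (fun x => ((f x + g x) ^+ 2)%:E).
Proof.
move=> mf mg if2 ig2.
apply: (le_integrable measurableT _ _ (integrableD measurableT
  (integrableZl measurableT 2 if2) (integrableZl measurableT 2 ig2))).
  by apply/measurable_EFinP/measurable_funX; exact: measurable_funD.
move=> x _; rewrite [X in (X <= _)%E]/=
  -[X in (_ <= X)%E]/(`|2 * f x ^+ 2 + 2 * g x ^+ 2|%:E) lee_fin.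
by rewrite (ger0_norm (sqr_ge0 _)) [leRHS]ger0_norm ?sqrD_le// addr_ge0// mulr_ge0// sqr_ge0.
Qed.

Lemma square_integrableZ f c :
  mu.-integrable setT (fun x => (f x ^+ 2)%:E) ->
  mu.-integrable setT (fun x => ((c * f x) ^+ 2)%:E).
Proof.
move=> if2; under eq_fun do rewrite exprMn EFinM.
exact: (integrableZl measurableT).
Qed.

Lemma square_integrableM f g : measurable_fun setT f -> measurable_fun setT g ->
  mu.-integrable setT (fun x => (f x ^+ 2)%:E) ->
  mu.-integrable setT (fun x => (g x ^+ 2)%:E) ->
  mu.-integrable setT (fun x => (f x * g x)%:E).
Proof.
move=> mf mg if2 ig2.
apply: (le_integrable measurableT _ _ (integrableD measurableT if2 ig2)).
  by apply/measurable_EFinP; exact: measurable_funM.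
move=> x _; rewrite [X in (X <= _)%E]/=
  -[X in (_ <= X)%E]/(`|f x ^+ 2 + g x ^+ 2|%:E) lee_fin.
move: (f x) (g x) => a b; rewrite [leRHS]ger0_norm ?addr_ge0 ?sqr_ge0//.
by rewrite ler_norml; have := sqr_ge0 (a - b); have := sqr_ge0 (a + b);
  move=> ? ?; apply/andP; split; nra.
Qed.

End square_integrable.

Lemma square_integrableW d (T : measurableType d) (R : realType)
    (mu : {finite_measure set T -> \bar R}) (f : T -> R) :
  measurable_fun setT f -> mu.-integrable setT (fun x => (f x ^+ 2)%:E) ->
  mu.-integrable setT (EFin \o f).
Proof.
move=> mf if2; rewrite (_ : EFin \o f = (fun x => (f x * cst 1 x)%:E)); last first.
  by apply/funext => x /=; rewrite mulr1.
apply: square_integrableM => //.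
exact: (finite_measure_integrable_cst mu (1 ^+ 2) measurableT).
Qed.

(** * Geometric sums and weighted sums of squares *)

Lemma sum_geometric_le (R : realType) (r : R) N : 0 <= r -> r < 1 ->
  \sum_(i < N) r ^+ i <= (1 - r)^-1.
Proof.
move=> r0 r1; have r10 : 0 < 1 - r by rewrite subr_gt0.
rewrite -[leRHS]mul1r ler_pdivlMr// mulrC.
rewrite (_ : (1 - r) * _ = 1 - r ^+ N); last first.
  by rewrite -[RHS]opprB subrX1 -mulNr opprB.
by rewrite lerBlDr lerDl exprn_ge0.
Qed.

(** Cauchy-Schwarz with the weights [r ^+ i], of total mass at most [(1 - r)^-1]; the constant is
    independent of [N], which makes the bound usable for series. *)
Lemma sum_sqr_le (R : realType) (a : nat -> R) (r : R) N : 0 < r -> r < 1 ->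
  (\sum_(i < N) a i) ^+ 2 <= (1 - r)^-1 * \sum_(i < N) (a i ^+ 2 / r ^+ i).
Proof.
move=> r0 r1; have r10 : 0 < 1 - r by rewrite subr_gt0.
elim: N a => [|N IH] a; first by rewrite !big_ord0 expr0n mulr0.
rewrite !big_ord_recl/= expr0 divr1.
have -> : \sum_(i < N) (a (lift ord0 i) ^+ 2 / r ^+ lift ord0 i) =
    r^-1 * \sum_(i < N) (a i.+1 ^+ 2 / r ^+ i).
  by rewrite mulr_sumr; apply: eq_bigr => i _; rewrite lift0 (exprS r) invfM mulrCA.
have -> : \sum_(i < N) a (lift ord0 i) = \sum_(i < N) a i.+1.
  by apply: eq_bigr => i _; rewrite lift0.
have := IH (fun i => a i.+1).
move: (\sum_(i < N) a i.+1) (\sum_(i < N) (a i.+1 ^+ 2 / r ^+ i)) (a 0) => S Q b.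
rewrite !ler_pdivlMl// => SQ.
have -> : b ^+ 2 + r^-1 * Q = r^-1 * (r * b ^+ 2 + Q).
  by rewrite mulrDr mulKf// gt_eqF.
rewrite ler_pdivlMl//.
apply: le_trans (_ : r * b ^+ 2 + (1 - r) * S ^+ 2 <= _); last by rewrite lerD2l.
(* The induction peels off the first term and rests on [(b + S) ^+ 2 <= b ^+ 2 / (1 - r) + S ^+ 2 /
   r], whose defect times [r * (1 - r)] is this square. *)
rewrite -subr_ge0 (_ : _ - _ = (r * b - (1 - r) * S) ^+ 2); last by ring.
exact: sqr_ge0.
Qed.

Lemma bounded_sum_cvg (R : realType) (a : nat -> R) (M : R) :
  (forall N, \sum_(i < N) `|a i| <= M) -> cvgn (fun N => \sum_(i < N) a i).
Proof.
move=> H; rewrite [X in cvgn X](_ : _ = series a); last by rewrite seriesEord.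
apply: normed_cvg.
apply: nondecreasing_is_cvgn.
  by apply: nondecreasing_series => n _ _; exact: normr_ge0.
exists M => _ [N _ <-]; apply: le_trans (H N);
  rewrite -(big_mkord xpredT (fun i => `|a i|)); exact: lexx.
Qed.

(** * Energy and operator of a symmetric kernel of mass at most one *)

Section nonlocal_operator.
Context d (T : measurableType d) (R : realType).

(** Extended-real values make this meaningful for every measurable [f]; upper bounds by it become
    trivial where it is infinite. *)
Definition energy_density (mu : {measure set T -> \bar R}) (k : T -> T -> R)
    (f : T -> R) x : \bar R :=
  (\int[mu]_y (k x y * (f x - f y) ^+ 2)%:E)%E.

Definition energy (mu : {measure set T -> \bar R}) k f : \bar R :=
  (\int[mu]_x energy_density mu k f x)%E.

(** The sign is opposite to that of the stationary equation, so that the operator is nonnegative. *)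
Definition nonlocal_op (mu : {measure set T -> \bar R}) (k : T -> T -> R)
    (f : T -> R) x : R :=
  (\int[mu]_y (k x y * (f x - f y)))%R.

Variable mu : {finite_measure set T -> \bar R}.
Variable k : T -> T -> R.
Hypothesis mk : measurable_fun setT (fun p : T * T => k p.1 p.2).
Hypothesis k0 : forall x y, 0 <= k x y.
Hypothesis ksym : forall x y, k x y = k y x.
Hypothesis k1 : forall x, (\int[mu]_y (k x y)%:E <= 1)%E.
Implicit Types f g : T -> R.
Local Notation e := (energy_density mu k).
Local Notation E := (energy mu k).
Local Notation L := (nonlocal_op mu k).
Local Notation sqi f := (mu.-integrable setT (fun x => (f x ^+ 2)%:E)).

Let mk1 x : measurable_fun setT (k x).
Proof. exact: (measurableT_comp mk (measurable_pair1 x)). Qed.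

Let mfst f : measurable_fun setT f -> measurable_fun setT (fun p : T * T => f p.1).
Proof. by move=> mf; exact: (measurableT_comp mf measurable_fst). Qed.

Let msnd f : measurable_fun setT f -> measurable_fun setT (fun p : T * T => f p.2).
Proof. by move=> mf; exact: (measurableT_comp mf measurable_snd). Qed.

Let mB1 f x : measurable_fun setT f -> measurable_fun setT (fun y => f x - f y).
Proof. by move=> mf; exact: measurable_funB. Qed.

Let mB f : measurable_fun setT f -> measurable_fun setT (fun p : T * T => f p.1 - f p.2).
Proof. by move=> mf; apply: measurable_funB; [exact: mfst|exact: msnd]. Qed.

Lemma energy_density_ge0 f x : (0 <= e f x)%E.
Proof. by apply: integral_ge0 => y _; rewrite lee_fin mulr_ge0// sqr_ge0. Qed.

Lemma energy_ge0 f : (0 <= E f)%E.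
Proof. by apply: integral_ge0 => x _; exact: energy_density_ge0. Qed.

Lemma measurable_energy_density f : measurable_fun setT f ->
  measurable_fun setT (e f).
Proof.
move=> mf.
apply: (measurable_fun_fubini_tonelli_F
  (fun p : T * T => (k p.1 p.2 * (f p.1 - f p.2) ^+ 2)%:E)).
  apply/measurable_EFinP; apply: measurable_funM => //.
  by apply: measurable_funX; exact: mB.
by move=> p; rewrite lee_fin mulr_ge0// sqr_ge0.
Qed.

Let mksnd (g : T -> \bar R) : measurable_fun setT g ->
  measurable_fun setT (fun p : T * T => (k p.1 p.2)%:E * g p.2)%E.
Proof.
move=> mg; apply: emeasurable_funM; first exact/measurable_EFinP.
exact: (measurableT_comp mg measurable_snd).
Qed.

Lemma integral_kernel_fst_le (g : T -> \bar R) : measurable_fun setT g ->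
  (forall x, 0 <= g x)%E ->
  (\int[mu]_x \int[mu]_y ((k x y)%:E * g x) <= \int[mu]_x g x)%E.
Proof.
move=> mg g0; apply: ge0_le_integral => //.
- by move=> x _; apply: integral_ge0 => y _; rewrite mule_ge0// lee_fin.
- apply: (measurable_fun_fubini_tonelli_F
    (fun p : T * T => (k p.1 p.2)%:E * g p.1)%E).
    apply: emeasurable_funM; first exact/measurable_EFinP.
    exact: (measurableT_comp mg measurable_fst).
  by move=> p; rewrite mule_ge0// lee_fin.
- move=> x _; rewrite ge0_integralZr//.
  + by rewrite -[leRHS]mul1e; apply: lee_wpmul2r.
  + exact/measurable_EFinP.
  + by move=> y _; rewrite lee_fin.
Qed.

(** Schur's test: after exchanging the integrals, symmetry turns the column masses of [k] into row
    masses. *)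
Lemma integral_kernel_snd_le (g : T -> \bar R) : measurable_fun setT g ->
  (forall x, 0 <= g x)%E ->
  (\int[mu]_x \int[mu]_y ((k x y)%:E * g y) <= \int[mu]_x g x)%E.
Proof.
move=> mg g0.
rewrite (fubini_tonelli (fun p : T * T => (k p.1 p.2)%:E * g p.2)%E)//=.
- apply: le_trans (integral_kernel_fst_le mg g0).
  by under eq_integral do under eq_integral do rewrite ksym.
- exact: mksnd.
- by move=> p; rewrite mule_ge0// lee_fin.
Qed.

(** Expanding the square by [sqrB_le] leaves one term for each variable, controlled by the row and
    column masses of [k]; in total at most four times the squared norm. *)
Lemma energy_lty f : measurable_fun setT f ->
  mu.-integrable setT (fun x => (f x ^+ 2)%:E) -> (E f < +oo)%E.
Proof.
move=> mf if2.
have mf2 : measurable_fun setT (fun x => (2 * f x ^+ 2)%:E).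
  by apply/measurable_EFinP; apply: measurable_funM => //; exact: measurable_funX.
have f20 x : (0 <= (2 * f x ^+ 2)%:E)%E by rewrite lee_fin mulr_ge0// sqr_ge0.
have f2oo : (\int[mu]_x (2 * f x ^+ 2)%:E < +oo)%E.
  by apply: integrable_lty => //; exact: (integrableZl measurableT 2 if2).
apply: (@le_lt_trans _ _ (\int[mu]_x \int[mu]_y
    ((k x y)%:E * (2 * f x ^+ 2)%:E + (k x y)%:E * (2 * f y ^+ 2)%:E)))%E.
  apply: ge0_le_integral => //.
  - by move=> x _; exact: energy_density_ge0.
  - exact: measurable_energy_density.
  - apply: (measurable_fun_fubini_tonelli_F
      (fun p : T * T => (k p.1 p.2)%:E * (2 * f p.1 ^+ 2)%:E
                      + (k p.1 p.2)%:E * (2 * f p.2 ^+ 2)%:E)%E).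
      apply: emeasurable_funD; last exact: (mksnd mf2).
      apply: emeasurable_funM; first exact/measurable_EFinP.
      exact: (measurableT_comp mf2 measurable_fst).
    by move=> p; rewrite adde_ge0// mule_ge0// lee_fin.
  - move=> x _; apply: ge0_le_integral => //.
    + by move=> y _; rewrite lee_fin mulr_ge0// sqr_ge0.
    + apply/measurable_EFinP; apply: measurable_funM => //.
      by apply: measurable_funX; exact: mB1.
    + apply: emeasurable_funD.
        by apply: emeasurable_funM => //; exact/measurable_EFinP.
      by apply: emeasurable_funM => //; exact/measurable_EFinP.
    + move=> y _; rewrite -!EFinM -EFinD lee_fin -mulrDr.
      by apply: ler_wpM2l => //; exact: sqrB_le.
have mkx x : measurable_fun setT (fun y => (k x y)%:E * (2 * f x ^+ 2)%:E)%E.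
  by apply: emeasurable_funM => //; exact/measurable_EFinP.
have mky x : measurable_fun setT (fun y => (k x y)%:E * (2 * f y ^+ 2)%:E)%E.
  by apply: emeasurable_funM => //; exact/measurable_EFinP.
under eq_integral => x _.
  rewrite ge0_integralD//; [over|..].
  - by move=> y _; rewrite mule_ge0// lee_fin.
  - by move=> y _; rewrite mule_ge0// lee_fin.
rewrite ge0_integralD//.
- by rewrite lte_add_pinfty//;
    [exact: le_lt_trans (integral_kernel_fst_le mf2 f20) f2oo
    |exact: le_lt_trans (integral_kernel_snd_le mf2 f20) f2oo].
- by move=> x _; apply: integral_ge0 => y _; rewrite mule_ge0// lee_fin.
- apply: (measurable_fun_fubini_tonelli_F
    (fun p : T * T => (k p.1 p.2)%:E * (2 * f p.1 ^+ 2)%:E)%E).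
    apply: emeasurable_funM; first exact/measurable_EFinP.
    exact: (measurableT_comp mf2 measurable_fst).
  by move=> p; rewrite mule_ge0// lee_fin.
- by move=> x _; apply: integral_ge0 => y _; rewrite mule_ge0// lee_fin.
- apply: (measurable_fun_fubini_tonelli_F
    (fun p : T * T => (k p.1 p.2)%:E * (2 * f p.2 ^+ 2)%:E)%E).
    exact: (mksnd mf2).
  by move=> p; rewrite mule_ge0// lee_fin.
Qed.

Lemma nonlocal_op_integrable f x : measurable_fun setT f -> (e f x < +oo)%E ->
  mu.-integrable setT (EFin \o (fun y => k x y * (f x - f y))).
Proof.
move=> mf efx; have := cauchy_schwarz_weight (mk1 x) (mB1 x mf) (k0 x) ltr01 (k1 x) efx.
by case.
Qed.

(** Jensen's inequality for the weight [k x], whose mass is at most one. *)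
Lemma nonlocal_op_sqr_le f x : measurable_fun setT f ->
  ((L f x ^+ 2)%:E <= e f x)%E.
Proof.
move=> mf; have [efx|] := ltP (e f x) +oo%E; last by rewrite leye_eq => /eqP ->; rewrite leey.
have := cauchy_schwarz_weight (mk1 x) (mB1 x mf) (k0 x) ltr01 (k1 x) efx.
by case=> _; rewrite mul1e.
Qed.

Lemma ae_energy_density_lty f : measurable_fun setT f -> (E f < +oo)%E ->
  {ae mu, forall x, (e f x < +oo)%E}.
Proof.
move=> mf Ef.
have : mu.-integrable setT (e f).
  apply/integrableP; split; first exact: measurable_energy_density.
  by under eq_integral => x _ do rewrite gee0_abs ?energy_density_ge0//.
move/integrable_ae => /(_ measurableT); apply: filterS => x /= /(_ I).
by rewrite ge0_fin_numE ?energy_density_ge0.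
Qed.

Let mF f g : measurable_fun setT f -> measurable_fun setT g ->
  measurable_fun setT (fun p : T * T => (k p.1 p.2 * (f p.1 - f p.2) * g p.1)%:E).
Proof.
move=> mf mg; apply/measurable_EFinP; apply: measurable_funM; last exact: mfst.
by apply: measurable_funM => //; exact: mB.
Qed.

(** The integrand is at most [k] times the sum of the two squares: one part is the energy of [f],
    the other the row mass against [g ^+ 2]. This is the absolute integrability that both orders of
    Fubini require. *)
Let integral_absF f g : measurable_fun setT f -> measurable_fun setT g ->
  sqi f -> sqi g ->
  (\int[mu]_x \int[mu]_y `|(k x y * (f x - f y) * g x)%:E| < +oo)%E.
Proof.
move=> mf mg if2 ig2.
have mg2 : measurable_fun setT (fun x => (g x ^+ 2)%:E).
  by apply/measurable_EFinP; exact: measurable_funX.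
have g20 x : (0 <= (g x ^+ 2)%:E)%E by rewrite lee_fin sqr_ge0.
have g2oo : (\int[mu]_x (g x ^+ 2)%:E < +oo)%E by exact: integrable_lty.
have mG : measurable_fun setT (fun p : T * T => (k p.1 p.2)%:E * (g p.1 ^+ 2)%:E)%E.
  apply: emeasurable_funM; first exact/measurable_EFinP.
  exact: (measurableT_comp mg2 measurable_fst).
have G0 x y : (0 <= (k x y)%:E * (g x ^+ 2)%:E)%E.
  by rewrite mule_ge0// lee_fin.
have mE : measurable_fun setT (fun p : T * T => (k p.1 p.2 * (f p.1 - f p.2) ^+ 2)%:E).
  apply/measurable_EFinP; apply: measurable_funM => //.
  by apply: measurable_funX; exact: mB.
have E0 x y : (0 <= (k x y * (f x - f y) ^+ 2)%:E)%E.
  by rewrite lee_fin mulr_ge0// sqr_ge0.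
apply: (@le_lt_trans _ _ (\int[mu]_x \int[mu]_y
    ((k x y * (f x - f y) ^+ 2)%:E + (k x y)%:E * (g x ^+ 2)%:E)))%E.
  apply: ge0_le_integral => //.
  - by move=> x _; apply: integral_ge0.
  - apply: (measurable_fun_fubini_tonelli_F
      (fun p : T * T => `|(k p.1 p.2 * (f p.1 - f p.2) * g p.1)%:E|%E)) => //.
    by apply: measurableT_comp => //; exact: mF.
  - apply: (measurable_fun_fubini_tonelli_F
      (fun p : T * T => (k p.1 p.2 * (f p.1 - f p.2) ^+ 2)%:E
         + (k p.1 p.2)%:E * (g p.1 ^+ 2)%:E)%E).
      exact: emeasurable_funD.
    by move=> p; rewrite adde_ge0.
  - move=> x _; apply: ge0_le_integral => //.
    + apply: measurableT_comp => //.
      exact: (measurableT_comp (mF mf mg) (measurable_pair1 x)).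
    + apply: emeasurable_funD.
        exact: (measurableT_comp mE (measurable_pair1 x)).
      exact: (measurableT_comp mG (measurable_pair1 x)).
    + move=> y _; rewrite -EFinM -EFinD lee_fin -mulrDr -mulrA normrM ger0_norm//.
      apply: ler_wpM2l => //; move: (f x - f y) (g x) => a b.
      by rewrite ler_norml; have := sqr_ge0 (a - b); have := sqr_ge0 (a + b);
        move=> ? ?; apply/andP; split; nra.
under eq_integral => x _.
  rewrite ge0_integralD//; [over|..].
  - exact: (measurableT_comp mE (measurable_pair1 x)).
  - exact: (measurableT_comp mG (measurable_pair1 x)).
rewrite ge0_integralD//.
- rewrite lte_add_pinfty//.
    exact: energy_lty.
  exact: le_lt_trans (integral_kernel_fst_le mg2 g20) g2oo.
- by move=> x _; exact: integral_ge0.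
- exact: measurable_energy_density.
- by move=> x _; exact: integral_ge0.
- exact: (measurable_fun_fubini_tonelli_F
    (fun p : T * T => (k p.1 p.2)%:E * (g p.1 ^+ 2)%:E)%E).
Qed.

Let integrableF f g : measurable_fun setT f -> measurable_fun setT g ->
  sqi f -> sqi g ->
  (mu \x mu)%E.-integrable setT
    (fun p : T * T => (k p.1 p.2 * (f p.1 - f p.2) * g p.1)%:E).
Proof.
move=> mf mg if2 ig2; apply/(integrable12ltyP mu mu (mF mf mg)).
exact: (integral_absF mf mg if2 ig2).
Qed.

Lemma measurable_nonlocal_op f : measurable_fun setT f -> sqi f ->
  measurable_fun setT (L f).
Proof.
move=> mf if2; apply: measurableT_comp => //.
(* Pairing with the constant 1 exhibits [L f] as an inner integral, whose measurability comes with
   Fubini. *)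
have i1 : sqi (cst 1 : T -> R).
  exact: (finite_measure_integrable_cst mu (1 ^+ 2) measurableT).
have := measurable_fubini_F (integrableF mf (measurable_cst _) if2 i1).
by apply: eq_measurable_fun => x _; rewrite /fubini_F/=; under eq_fun do rewrite mulr1.
Qed.

Lemma nonlocal_op_square_integrable f : measurable_fun setT f -> sqi f ->
  sqi (L f) /\ (\int[mu]_x (L f x ^+ 2)%:E <= E f)%E.
Proof.
move=> mf if2.
have mL2 : measurable_fun setT (fun x => L f x ^+ 2).
  by apply: measurable_funX; exact: measurable_nonlocal_op.
have LE : (\int[mu]_x (L f x ^+ 2)%:E <= E f)%E.
  apply: ge0_le_integral => //.
  - by move=> x _; rewrite lee_fin sqr_ge0.
  - exact/measurable_EFinP.
  - exact: measurable_energy_density.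
  - by move=> x _; exact: nonlocal_op_sqr_le.
split=> //; apply: integrable_ge0 => //; first by move=> x; exact: sqr_ge0.
by apply: le_lt_trans LE _; exact: energy_lty.
Qed.

(** Exchanging the two variables turns [F] into [F'] without changing the integral, and by symmetry
    of [k] the sum of the two is the symmetric form. Taking [g = 1] gives the zero mean of [L f],
    taking [g = f] the energy identity. *)
Lemma nonlocal_op_pairing f g : measurable_fun setT f -> measurable_fun setT g ->
  sqi f -> sqi g ->
  ((2 * \int[mu]_x (L f x * g x)%R)%:E =
   \int[(mu \x mu)]_p (k p.1 p.2 * (f p.1 - f p.2) * (g p.1 - g p.2))%:E)%E.
Proof.
move=> mf mg if2 ig2.
have iF := integrableF mf mg if2 ig2.
set F := (fun p : T * T => (k p.1 p.2 * (f p.1 - f p.2) * g p.1)%:E) in iF.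
pose F' (p : T * T) := F (p.2, p.1).
have mF' : measurable_fun setT F'.
  apply: (measurableT_comp (mF mf mg)).
  exact: measurable_fun_pair measurable_snd measurable_fst.
have iF' : (mu \x mu)%E.-integrable setT F'.
  apply/(integrable21ltyP mu mu mF').
  exact: (integral_absF mf mg if2 ig2).
have FE : (\int[(mu \x mu)]_p F p = (\int[mu]_x (L f x * g x)%R)%:E)%E.
  have [iL2 _] := nonlocal_op_square_integrable mf if2.
  have mL := measurable_nonlocal_op mf if2.
  have iLg := square_integrableM mL mg iL2 ig2.
  rewrite [RHS]fineK; last exact: integrable_fin_num.
  rewrite -integral12_prod_meas1//; apply: ae_eq_integral => //.
  - exact: (measurable_fubini_F iF).
  - by apply/measurable_EFinP; exact: measurable_funM.
  - have := ae_energy_density_lty mf (energy_lty mf if2).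
    apply: filterS => x ex _.
    have iL := nonlocal_op_integrable mf ex.
    rewrite /fubini_F /F /nonlocal_op /= -RintegralZr// /Rintegral fineK//.
    apply: integrable_fin_num => //.
    under eq_fun do rewrite EFinM.
    exact: (integrableZr measurableT (g x) iL).
have F'E : (\int[(mu \x mu)]_p F' p = (\int[mu]_x (L f x * g x)%R)%:E)%E.
  by rewrite -integral21_prod_meas1// -FE -integral12_prod_meas1.
rewrite mulr2n mulrDl mul1r EFinD -{1}FE -F'E -integralD//.
apply: eq_integral => -[x y] _ /=; rewrite /F' /F/= -EFinD; congr EFin.
by rewrite (ksym y x); ring.
Qed.

Lemma integral_nonlocal_op f : measurable_fun setT f -> sqi f ->
  (\int[mu]_x L f x = 0)%R.
Proof.
move=> mf if2.
have i1 : sqi (cst 1 : T -> R).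
  exact: (finite_measure_integrable_cst mu (1 ^+ 2) measurableT).
have m1 : measurable_fun setT (cst 1 : T -> R) by [].
have := nonlocal_op_pairing mf m1 if2 i1.
rewrite (eq_integral (cst 0%E)); last by move=> p _ /=; rewrite subrr mulr0.
rewrite integral0 => -[] /eqP; rewrite mulf_eq0 pnatr_eq0/= => /eqP.
by under eq_Rintegral do rewrite mulr1.
Qed.

Lemma energyE f : measurable_fun setT f -> sqi f ->
  (E f = (2 * \int[mu]_x (L f x * f x)%R)%:E)%E.
Proof.
move=> mf if2; rewrite (nonlocal_op_pairing mf mf if2 if2) fubini_tonelli1//.
- by apply: eq_integral => x _; apply: eq_integral => y _; rewrite /= -mulrA -expr2.
- apply/measurable_EFinP; apply: measurable_funM; last exact: mB.
  by apply: measurable_funM => //; exact: mB.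
- by move=> p; rewrite lee_fin -mulrA mulr_ge0// -expr2 sqr_ge0.
Qed.

(** * Solving the equation from a Poincare inequality *)

Section existence.
Variable C : R.
Hypothesis C1 : 1 <= C.
Hypothesis poincare : forall f, measurable_fun setT f -> sqi f ->
  (\int[mu]_x f x = 0)%R -> (\int[mu]_x (f x ^+ 2)%:E <= C%:E * E f)%E.

(** For a step [t] the squared norm changes by at most [(t ^+ 2 - t) * E f]. The best choice
    [t = 2^-1] removes a quarter of the energy, which the Poincare inequality bounds below by
    [(4 * C)^-1] times the squared norm; hence the ratio [q]. *)
Definition richardson_step f x := f x - 2^-1 * L f x.

Let q := 1 - (4 * C)^-1.

Lemma richardson_stepP f : measurable_fun setT f -> sqi f ->
  (\int[mu]_x f x = 0)%R ->
  [/\ measurable_fun setT (richardson_step f), sqi (richardson_step f),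
    (\int[mu]_x richardson_step f x = 0)%R &
    (\int[mu]_x (richardson_step f x ^+ 2) <= q * \int[mu]_x (f x ^+ 2))%R].
Proof.
move=> mf if2 f0.
have mL := measurable_nonlocal_op mf if2.
have [iL2 LE] := nonlocal_op_square_integrable mf if2.
have mL' : measurable_fun setT (fun x => - 2^-1 * L f x) by exact: measurable_funM.
have iL' := square_integrableZ (- 2^-1) iL2.
have stepE : richardson_step f = (fun x => f x + (- 2^-1) * L f x).
  by apply/funext => x; rewrite mulNr.
have iL := square_integrableW mL iL2.
split.
- by rewrite stepE; exact: measurable_funD.
- by rewrite stepE; exact: square_integrableD.
- rewrite stepE RintegralD//; last 2 first.
  + exact: square_integrableW.
  + exact: (integrableZl measurableT _ iL).
  by rewrite f0 RintegralZl// integral_nonlocal_op// mulr0 addr0.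
have iLf := square_integrableM mL mf iL2 if2.
have i1 : mu.-integrable setT (EFin \o (fun x => 4^-1 * L f x ^+ 2)).
  exact: (integrableZl measurableT _ iL2).
have -> : (\int[mu]_x (richardson_step f x ^+ 2))%R =
    (\int[mu]_x (f x ^+ 2) - \int[mu]_x (L f x * f x) + 4^-1 * \int[mu]_x (L f x ^+ 2))%R.
  under eq_Rintegral => x _.
    rewrite (_ : _ ^+ 2 = f x ^+ 2 - L f x * f x + 4^-1 * L f x ^+ 2); last first.
      by rewrite /richardson_step; field.
    over.
  rewrite RintegralD//; last exact: (integrableB measurableT if2 iLf).
  by rewrite RintegralB// RintegralZl.
have EE := energyE mf if2.
have {}LE : (\int[mu]_x (L f x ^+ 2) <= 2 * \int[mu]_x (L f x * f x))%R.
  by rewrite -lee_fin -EE fineK//; exact: integrable_fin_num.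
have PC : (\int[mu]_x (f x ^+ 2) <= C * (2 * \int[mu]_x (L f x * f x)))%R.
  rewrite -lee_fin EFinM -EE fineK; last exact: integrable_fin_num.
  exact: poincare.
move: (\int[mu]_x (f x ^+ 2))%R (\int[mu]_x (L f x * f x))%R (\int[mu]_x (L f x ^+ 2))%R
  LE PC => N b l lb NC.
have C0 : 0 < C by apply: lt_le_trans C1.
have : (4 * C)^-1 * N <= 2^-1 * b.
  by rewrite ler_pdivrMl ?mulr_gt0//; apply: le_trans NC _; rewrite le_eqVlt; apply/orP; left; apply/eqP; field.
rewrite /q mulrBl mul1r; lra.
Qed.

Variable H : T -> R.
Hypothesis mH : measurable_fun setT H.
Hypothesis iH2 : sqi H.
Hypothesis H0 : (\int[mu]_x H x = 0)%R.

(** These are the terms of a Neumann series: formally, the inverse of [L] is half the inverse of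
    [1 - (1 - L / 2)], applied here to [H]. The iterates are summed, not taken as approximate
    solutions. *)
Definition richardson n := iter n richardson_step (fun x => 2^-1 * H x).

Lemma richardsonP n :
  [/\ measurable_fun setT (richardson n), sqi (richardson n),
    (\int[mu]_x richardson n x = 0)%R &
    (\int[mu]_x (richardson n x ^+ 2) <= q ^+ n * \int[mu]_x (richardson 0 x ^+ 2))%R].
Proof.
elim: n => [|n [mf if2 f0 fle]].
  split; rewrite ?expr0 ?mul1r//=.
  - exact: measurable_funM.
  - exact: square_integrableZ.
  - rewrite RintegralZl// ?H0 ?mulr0//; exact: square_integrableW.
have [? ? ? le] := richardson_stepP mf if2 f0; split => //.
apply: le_trans le _; rewrite exprS -mulrA; apply: ler_wpM2l => //.
rewrite /q subr_ge0 invf_le1; last by rewrite mulr_gt0//; apply: lt_le_trans C1.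
by have := C1; lra.
Qed.

(* Any ratio in ]q, 1[ would do: the squared norms of the increments decay like
   q^n, so their sum weighted by r^-n is finite. *)
Let r := (1 + q) / 2.
Let incr n x := richardson n x.
Let G x : \bar R := (\sum_(0 <= n <oo) (incr n x ^+ 2 / r ^+ n)%:E)%E.
Let c := (1 - r)^-1.
Let psum N x := \sum_(n < N) incr n x.
(** The value 0 where [G] is infinite keeps [phi] a limit of measurable functions at every point,
    and makes [phi x ^+ 2 <= c * G x] hold everywhere. *)
Let phi x := if (G x < +oo)%E then limn (psum^~ x) else 0.

Let q0 : 0 < q.
Proof.
rewrite /q subr_gt0 invf_lt1; last by rewrite mulr_gt0//; apply: lt_le_trans C1.
by have := C1; lra.
Qed.

Let q1 : q < 1.
Proof. by rewrite /q ltrBlDr ltrDl invr_gt0 mulr_gt0//; apply: lt_le_trans C1. Qed.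

Let r0 : 0 < r. Proof. by rewrite /r; have := q0; lra. Qed.
Let r1 : r < 1. Proof. by rewrite /r; have := q1; lra. Qed.
Let qr : q < r. Proof. by rewrite /r; have := q1; lra. Qed.
Let c0 : 0 < c. Proof. by rewrite /c invr_gt0 subr_gt0. Qed.

Let dlP n := richardsonP n.

Let mdl n : measurable_fun setT (incr n).
Proof. by have [] := dlP n. Qed.

Let idl n : sqi (incr n).
Proof. by have [] := dlP n. Qed.

Let Gt_ge0 n x : (0 <= (incr n x ^+ 2 / r ^+ n)%:E)%E.
Proof. by rewrite lee_fin divr_ge0 ?sqr_ge0// exprn_ge0// ltW. Qed.

Let mGt n : measurable_fun setT (fun x => (incr n x ^+ 2 / r ^+ n)%:E).
Proof.
apply/measurable_EFinP; apply: measurable_funM => //.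
by apply: measurable_funX.
Qed.

Let mG : measurable_fun setT G.
Proof. by apply: ge0_emeasurable_sum. Qed.

Let G0 x : (0 <= G x)%E.
Proof. by apply: nneseries_ge0 => n _ _; exact: Gt_ge0. Qed.

Let integral_G : (\int[mu]_x G x < +oo)%E.
Proof.
rewrite /G integral_nneseries//.
set N0 := (\int[mu]_x (incr 0 x ^+ 2))%R.
have N00 : 0 <= N0 by apply: Rintegral_ge0 => x _; exact: sqr_ge0.
have th0 : 0 <= q / r by rewrite divr_ge0// ltW.
have th1 : q / r < 1 by rewrite ltr_pdivrMr// mul1r.
apply: (@le_lt_trans _ _ (N0 * (1 - q / r)^-1)%:E); last by rewrite ltry.
apply: lime_le.
  by apply: is_cvg_nneseries => n _ _; apply: integral_ge0 => x _.
apply: nearW => N; rewrite big_mkord.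
apply: (@le_trans _ _ (\sum_(n < N) (N0 * (q / r) ^+ n)%:E)%E).
  apply: lee_sum => n _.
  under eq_integral => x _ do rewrite mulrC EFinM.
  rewrite ge0_integralZl//; last 3 first.
  - by apply/measurable_EFinP; apply: measurable_funX.
  - by move=> x _; rewrite lee_fin sqr_ge0.
  - by rewrite lee_fin invr_ge0 exprn_ge0// ltW.
  have [_ i2 _ le] := dlP n.
  have -> : (\int[mu]_x (incr n x ^+ 2)%:E)%E = ((\int[mu]_x (incr n x ^+ 2))%R)%:E.
    by rewrite fineK//; exact: integrable_fin_num.
  rewrite -EFinM lee_fin.
  rewrite (_ : N0 * (q / r) ^+ n = (r ^+ n)^-1 * (q ^+ n * N0)); last first.
    by rewrite expr_div_n mulrC -mulrA mulrCA.
  by apply: ler_wpM2l => //; rewrite invr_ge0 exprn_ge0// ltW.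
by rewrite sumEFin lee_fin -mulr_sumr; apply: ler_wpM2l => //; exact: sum_geometric_le.
Qed.

Let ph_sqr_le N x : ((psum N x ^+ 2)%:E <= c%:E * G x)%E.
Proof.
apply: (@le_trans _ _ (c%:E * (\sum_(n < N) (incr n x ^+ 2 / r ^+ n))%:E)%E).
  by rewrite -EFinM lee_fin; exact: (sum_sqr_le (incr^~ x) N r0 r1).
apply: lee_wpmul2l; first by rewrite lee_fin ltW.
by rewrite -sumEFin -(big_mkord xpredT (fun n => (incr n x ^+ 2 / r ^+ n)%:E)); exact: nneseries_lim_ge.
Qed.

Let cvg_ph x : (G x < +oo)%E -> cvgn (psum^~ x).
Proof.
move=> Gx; apply: (@bounded_sum_cvg _ (incr^~ x) (1 + c * fine (G x))) => N.
have : ((\sum_(i < N) `|incr i x|) ^+ 2 <= c * fine (G x)).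
  apply: le_trans (sum_sqr_le (fun i => `|incr i x|) N r0 r1) _.
  apply: ler_wpM2l; first exact: ltW.
  under eq_bigr do rewrite real_normK ?num_real//.
  rewrite -lee_fin fineK ?ge0_fin_numE//.
  by rewrite -sumEFin -(big_mkord xpredT (fun n => (incr n x ^+ 2 / r ^+ n)%:E)); exact: nneseries_lim_ge.
(* Uses [s <= 1 + s ^+ 2], which explains the summand 1 in the bound on the absolute sums. *)
by move: (\sum_(i < N) _) => s; nra.
Qed.

Let ph_phi x : (G x < +oo)%E -> psum N x @[N --> \oo] --> phi x.
Proof. by move=> Gx; rewrite /phi Gx; exact: cvg_ph. Qed.

Let mph N : measurable_fun setT (psum N).
Proof. by apply: measurable_sum. Qed.

Let mphi : measurable_fun setT phi.
Proof.
have mS : measurable [set x | G x < +oo]%E.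
  by rewrite -[X in measurable X]setTI; exact: emeasurable_fun_infty_o.
apply: (@measurable_fun_cvg _ _ _ setT (fun N x => psum N x * \1_[set x | G x < +oo]%E x)).
  by move=> N; apply: measurable_funM.
move=> x _; rewrite indicE; have [Gx|Gx] := boolP (G x < +oo)%E.
  by rewrite mem_set//; under eq_fun do rewrite mulr1; exact: ph_phi.
rewrite memNset//; last exact/negP.
under eq_fun do rewrite mulr0.
by rewrite /phi (negbTE Gx); exact: cvg_cst.
Qed.

Let phi_sqr_le x : ((phi x ^+ 2)%:E <= c%:E * G x)%E.
Proof.
have [Gx|Gx] := boolP (G x < +oo)%E; last first.
  by rewrite /phi (negbTE Gx) expr0n mule_ge0// lee_fin ltW.
have Gfin : G x \is a fin_num by rewrite ge0_fin_numE.
rewrite -(fineK Gfin) -EFinM lee_fin.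
have h : psum N x ^+ 2 @[N --> \oo] --> phi x ^+ 2.
  by rewrite expr2; under eq_fun do rewrite expr2; apply: cvgM; exact: ph_phi.
rewrite -(cvg_lim _ h)//; apply: limr_le; first by apply/cvg_ex; exists (phi x ^+ 2).
by apply: nearW => N; rewrite -lee_fin [leRHS]EFinM fineK//; exact: ph_sqr_le.
Qed.

Let iphi : sqi phi.
Proof.
apply: integrable_ge0.
- by apply: measurable_funX.
- by move=> x; exact: sqr_ge0.
apply: (@le_lt_trans _ _ (\int[mu]_x (c%:E * G x))%E).
  apply: ge0_le_integral => //.
  - by move=> x _; rewrite lee_fin sqr_ge0.
  - by apply/measurable_EFinP; apply: measurable_funX.
  - exact: emeasurable_funM.
rewrite ge0_integralZl//; last by rewrite lee_fin ltW.
by rewrite lte_mul_pinfty// lee_fin ltW.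
Qed.

(** The recursion reads [L (incr n) = 2 * (incr n - incr n.+1)], so the sum telescopes. Finite
    energy densities at [x] justify splitting the integral. *)
Let sum_nonlocal_op x N : (forall n, (e (incr n) x < +oo)%E) ->
  mu.-integrable setT (EFin \o (fun y => k x y * (psum N x - psum N y))) /\
  L (psum N) x = 2 * (incr 0 x - incr N x).
Proof.
move=> ex; elim: N => [|N [iN LN]].
  rewrite /nonlocal_op /psum; under [X in EFin \o X]eq_fun do rewrite !big_ord0 subrr mulr0.
  under eq_Rintegral do rewrite !big_ord0 subrr mulr0.
  split; first exact: (integrable0 mu setT).
  by rewrite Rintegral_cst// mul0r subrr mulr0.
have iL := nonlocal_op_integrable (mdl N) (ex N).
have phS : (fun y => k x y * (psum N.+1 x - psum N.+1 y)) =
    (fun y => k x y * (psum N x - psum N y) + k x y * (incr N x - incr N y)).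
  by apply/funext => y; rewrite /psum !big_ord_recr/=; ring.
rewrite /nonlocal_op phS; split; first exact: (integrableD measurableT iN iL).
rewrite RintegralD// -/(L (psum N) x) -/(L (incr N) x) LN.
have -> : incr N.+1 x = incr N x - 2^-1 * L (incr N) x by [].
by field.
Qed.

(** For almost every fixed [x], dominated convergence in [y] passes to the limit in the telescoped
    identity; [G] provides the majorant. *)
Lemma nonlocal_equation_solvable : exists phi : T -> R,
  [/\ measurable_fun setT phi, sqi phi &
    {ae mu, forall x, [/\ mu.-integrable setT (EFin \o (fun y => k x y * (phi x - phi y)))
      & L phi x = H x]}].
Proof.
exists phi; split=> //.
have aeG : {ae mu, forall x, (G x < +oo)%E}.
  have : mu.-integrable setT G.
    by apply/integrableP; split=> //; under eq_integral => x _ do rewrite gee0_abs//.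
  move/integrable_ae => /(_ measurableT); apply: filterS => x /= /(_ I).
  by rewrite ge0_fin_numE.
have mkG : measurable_fun setT (fun p : T * T => (k p.1 p.2)%:E * G p.2)%E.
  apply: emeasurable_funM; first exact/measurable_EFinP.
  exact: (measurableT_comp mG measurable_snd).
have kG0 x y : (0 <= (k x y)%:E * G y)%E by rewrite mule_ge0// lee_fin.
(* The majorant contains [k x y * G y], and Schur's test makes its integral in [y] finite for almost
   every [x]. *)
have aekG : {ae mu, forall x, (\int[mu]_y ((k x y)%:E * G y) < +oo)%E}.
  have : mu.-integrable setT (fun x => \int[mu]_y ((k x y)%:E * G y))%E.
    apply/integrableP; split=> //.
      exact: (measurable_fun_fubini_tonelli_F
        (fun p : T * T => (k p.1 p.2)%:E * G p.2)%E).
    under eq_integral => x _ do rewrite gee0_abs ?integral_ge0//.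
    exact: le_lt_trans (integral_kernel_snd_le mG G0) integral_G.
  move/integrable_ae => /(_ measurableT); apply: filterS => x /= /(_ I).
  by rewrite ge0_fin_numE// integral_ge0.
have aee : {ae mu, forall x, forall n, (e (incr n) x < +oo)%E}.
  apply: ae_foralln => n; apply: ae_energy_density_lty => //.
  exact: energy_lty.
have aep := ae_energy_density_lty mphi (energy_lty mphi iphi).
apply: filterS (filterI (filterI aeG aekG) (filterI aee aep)).
move=> x [[Gx kGx] [ex epx]].
split; first exact: nonlocal_op_integrable.
have mf f : measurable_fun setT f -> measurable_fun setT (fun y => (k x y * (f x - f y))%:E).
  by move=> ?; apply/measurable_EFinP; apply: measurable_funM => //; exact: mB1.
(* The shape comes from [|a - b| <= 2 + a ^+ 2 + b ^+ 2] applied to partial sums, whose squares are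
   at most [c * G]. *)
pose g y := ((k x y)%:E * ((2 + c * fine (G x))%:E + c%:E * G y))%E.
have Gfin : G x \is a fin_num by rewrite ge0_fin_numE.
have b0 : 0 <= 2 + c * fine (G x).
  by rewrite addr_ge0// mulr_ge0 ?fine_ge0// ltW.
have mkx : measurable_fun setT (fun y => (k x y)%:E) by exact/measurable_EFinP.
have ig : mu.-integrable setT g.
  have g0 y : (0 <= g y)%E.
    by rewrite mule_ge0 ?lee_fin// adde_ge0 ?lee_fin// mule_ge0// lee_fin ltW.
  apply/integrableP; split.
    by apply: emeasurable_funM => //; apply: emeasurable_funD => //; exact: emeasurable_funM.
  under eq_integral => y _.
    rewrite gee0_abs// /g ge0_muleDr ?lee_fin//; last by rewrite mule_ge0// lee_fin ltW.
    rewrite (muleCA _ c%:E).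
    over.
  have mkGx : measurable_fun setT (fun y => (k x y)%:E * G y)%E by exact: emeasurable_funM.
  rewrite ge0_integralD//.
  - rewrite ge0_integralZr//; last by move=> y _; rewrite lee_fin.
    rewrite ge0_integralZl//; last by rewrite lee_fin ltW.
    rewrite lte_add_pinfty//.
      rewrite muleC lte_mul_pinfty//.
      exact: le_lt_trans (k1 x) (ltry _).
    by rewrite lte_mul_pinfty// lee_fin ltW.
  - by move=> y _; rewrite mule_ge0// lee_fin.
  - by apply: emeasurable_funM.
  - by move=> y _; rewrite mule_ge0// lee_fin ltW.
  - by apply: emeasurable_funM.
have cvgf : {ae mu, forall y, setT y ->
    (k x y * (psum N x - psum N y))%:E @[N --> \oo] --> (k x y * (phi x - phi y))%:E}.
  apply: filterS aeG => y Gy _; apply: cvg_EFin; first exact: nearW.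
  by apply: cvgM; [exact: cvg_cst|apply: cvgB; exact: ph_phi].
have boundf : {ae mu, forall y, forall N, setT y ->
    (`|(k x y * (psum N x - psum N y))%:E| <= g y)%E}.
  apply: filterS aeG => y Gy N _.
  have Gyfin : G y \is a fin_num by rewrite ge0_fin_numE.
  rewrite /g -(fineK Gyfin).
  change (`|k x y * (psum N x - psum N y)|%:E <=
    (k x y * (2 + c * fine (G x) + c * fine (G y)))%:E)%E.
  rewrite lee_fin normrM ger0_norm//.
  apply: ler_wpM2l => //.
  have := ph_sqr_le N x; rewrite -(fineK Gfin) -EFinM lee_fin.
  have := ph_sqr_le N y; rewrite -(fineK Gyfin) -EFinM lee_fin.
  move: (psum N x) (psum N y) (c * fine (G x)) (c * fine (G y)) => a b A B bB aA.
  have := sqr_ge0 (a - 1); have := sqr_ge0 (a + 1).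
  have := sqr_ge0 (b - 1); have := sqr_ge0 (b + 1).
  by move=> ? ? ? ?; rewrite ler_norml; apply/andP; split; nra.
have [_ _ cvgL] := dominated_convergence measurableT (fun N => mf _ (mph N))
  (mf _ mphi) cvgf ig boundf.
have cvgH : (\int[mu]_y (k x y * (psum N x - psum N y))%:E)%E @[N --> \oo] --> (H x)%:E.
  rewrite [X in X @ _ --> _](_ : _ = fun N => (2 * (incr 0 x - incr N x))%:E); last first.
    apply/funext => N; have [iN <-] := sum_nonlocal_op N ex.
    by rewrite fineK//; exact: integrable_fin_num.
  apply: cvg_EFin; first exact: nearW.
  (* The iteration starts from [H / 2], and the increments tend to 0 as terms of a convergent
     series. *)
  have -> : H x = 2 * (incr 0 x - 0) by rewrite subr0 /incr/= mulVKf.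
  apply: cvgM; first exact: cvg_cst.
  apply: cvgB; first exact: cvg_cst.
  apply: cvg_series_cvg_0; rewrite seriesEord; exact: cvg_ph.
apply: EFin_inj; rewrite -(cvg_unique _ cvgL cvgH)//.
by rewrite fineK//; apply: integrable_fin_num => //; exact: nonlocal_op_integrable.
Qed.

End existence.

(* The pointwise form of the Poincare inequality: unlike its integrated form it
   can be chained through an intermediate set of positive measure. *)
Definition linked (A B : set T) := exists2 C : R, 0 < C &
  forall f, measurable_fun setT f -> forall x y, A x -> B y ->
  (((f x - f y) ^+ 2)%:E <= C%:E * (e f x + e f y + E f))%E.

Let e0 f x : (0 <= e f x)%E. Proof. exact: energy_density_ge0. Qed.
Let E0 f : (0 <= E f)%E. Proof. exact: energy_ge0. Qed.

Lemma linkedS A B A' B' : A' `<=` A -> B' `<=` B -> linked A B -> linked A' B'.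
Proof.
move=> AA BB [C C0 H]; exists C => // f mf x y Ax By.
by apply: H => //; [exact: AA|exact: BB].
Qed.

(** Pass through an intermediate [z] and average over [z] in [B]: the unwanted term [e f z] then
    integrates to at most [E f]. This is why the total energy appears in the definition of
    [linked]. *)
Lemma linked_trans A B D : measurable B -> (0 < mu B)%E ->
  linked A B -> linked B D -> linked A D.
Proof.
move=> msB B0 [C1 C10 H1] [C2 C20 H2].
pose m := fine (mu B).
have mE : mu B = m%:E by rewrite fineK// fin_num_measure.
have m0 : 0 < m by rewrite -lte_fin -mE.
pose K := 2 * C1 + 2 * C2.
have K0 : 0 < K by rewrite addr_gt0// mulr_gt0.
exists (K * (1 + m^-1)).
  by rewrite mulr_gt0// addr_gt0// invr_gt0.
move=> f mf x y Ax Dy.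
have W0 : (0 <= e f x + e f y + E f)%E by apply: adde_ge0; [exact: adde_ge0|].
apply: (@le_trans _ _ (K%:E * (e f x + e f y + E f) + m^-1%:E * (\int[mu]_z (K%:E * e f z)))%E).
  apply: (averaging (S := B)) => //.
  - by apply: emeasurable_funM => //; exact: measurable_energy_density.
  - by move=> z; rewrite mule_ge0// lee_fin ltW.
  - by rewrite mule_ge0// lee_fin ltW.
  - by rewrite -mE.
  move=> z Bz.
  apply: (@le_trans _ _ ((2 * C1)%:E * (e f x + e f z + E f) +
                         (2 * C2)%:E * (e f z + e f y + E f))%E).
    apply: (@le_trans _ _ (2%:E * ((f x - f z) ^+ 2)%:E + 2%:E * ((f z - f y) ^+ 2)%:E)%E).
      rewrite -!EFinM -EFinD lee_fin.
      by apply: le_trans (sqrD_le _ _); rewrite addrA subrK.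
    rewrite !EFinM -!muleA; apply: leeD; apply: lee_wpmul2l => //; [exact: H1|exact: H2].
  rewrite -ge0_muleDr//.
  have -> : (e f x + e f y + E f + e f z = e f x + e f z + e f y + E f)%E.
    by rewrite addeAC; congr (_ + _)%E; rewrite addeAC.
  have C1' : (0 <= (2 * C1)%:E)%E by rewrite lee_fin mulr_ge0// ltW.
  have C2' : (0 <= (2 * C2)%:E)%E by rewrite lee_fin mulr_ge0// ltW.
  rewrite EFinD (ge0_muleDl _ C1' C2').
  apply: leeD; apply: lee_wpmul2l => //.
  - by rewrite leeD2r// leeDl.
  - by apply: leeD => //; apply: leeD => //; rewrite leeDr.
rewrite ge0_integralZl//; last 2 first.
- exact: measurable_energy_density.
- by rewrite lee_fin ltW.
have K0' : (0 <= K%:E)%E by rewrite lee_fin ltW.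
have Km : (0 <= (K * m^-1)%:E)%E by rewrite lee_fin mulr_ge0 ?invr_ge0 1?ltW.
rewrite mulrDr mulr1 EFinD (ge0_muleDl _ K0' Km).
apply: leeD => //; rewrite muleA -EFinM mulrC.
apply: lee_wpmul2l => //.
by rewrite leeDr// adde_ge0.
Qed.

(** For [z] in the overlap, [(f x - f z) ^+ 2] is at most [eta^-1] times the integrand of [e f x],
    and likewise for [y]; averaging over the overlap removes [z]. *)
Lemma linked_overlap (A : set T) (eta m : R) : 0 < eta -> 0 < m ->
  (forall x y, A x -> A y -> (m%:E <= mu [set z | (eta <= k x z)%R /\ (eta <= k y z)%R])%E) ->
  linked A A.
Proof.
move=> eta0 m0 H.
exists (m^-1 * (2 / eta)); first by rewrite mulr_gt0 ?invr_gt0// divr_gt0.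
move=> f mf x y Ax Ay.
have mex u : measurable_fun setT (fun z => (k u z * (f u - f z) ^+ 2)%:E).
  by apply/measurable_EFinP; apply: measurable_funM => //; apply: measurable_funX; exact: mB1.
have ex0 u z : (0 <= (k u z * (f u - f z) ^+ 2)%:E)%E.
  by rewrite lee_fin mulr_ge0// sqr_ge0.
pose g z := ((2 / eta)%:E * ((k x z * (f x - f z) ^+ 2)%:E + (k y z * (f y - f z) ^+ 2)%:E))%E.
have c0 : 0 <= 2 / eta by rewrite divr_ge0// ltW.
have mS : measurable [set z | eta <= k x z /\ eta <= k y z].
  apply: measurableI.
  - by rewrite -[X in measurable X]setTI; apply: measurable_fun_le.
  - by rewrite -[X in measurable X]setTI; apply: measurable_fun_le.
apply: (@le_trans _ _ (0 + m^-1%:E * (\int[mu]_z g z))%E).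
  apply: (averaging mS) => //.
  - by apply: emeasurable_funM => //; exact: emeasurable_funD.
  - by move=> z; rewrite mule_ge0 ?lee_fin// addr_ge0// mulr_ge0// sqr_ge0.
  - exact: H.
  move=> z [xz yz]; rewrite add0e /g -EFinD -EFinM lee_fin.
  have le1 u : eta <= k u z -> (f u - f z) ^+ 2 <= eta^-1 * (k u z * (f u - f z) ^+ 2).
    by move=> uz; rewrite ler_pdivlMl// ler_wpM2r// sqr_ge0.
  rewrite mulrDr -!(mulrA 2).
  apply: le_trans (lerD (ler_wpM2l _ (le1 x xz)) (ler_wpM2l _ (le1 y yz))) => //.
  by apply: le_trans (sqrB_le _ _); rewrite opprB addrA subrK.
rewrite add0e /g ge0_integralZl//; last 2 first.
- exact: emeasurable_funD.
- by move=> z _; rewrite adde_ge0.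
rewrite muleA -EFinM; apply: lee_wpmul2l.
  by rewrite lee_fin mulr_ge0// invr_ge0 ltW.
by rewrite ge0_integralD// leeDl.
Qed.

(** * From links to the Poincare inequality and to the kernel of the operator *)

Section linked_everywhere.
Variable D : set T.
Hypothesis aeD : {ae mu, forall x, D x}.
Hypothesis muT : (0 < mu setT)%E.
Hypothesis linkD : linked D D.

(** A mean-zero [f] satisfies [m * f x ^+ 2 <= \int (f x - f y) ^+ 2] in [y], by Cauchy-Schwarz with
    constant weight. Inserting the link and integrating over both variables gives the constant
    [C * (2 + m)]; the extra 1 secures [1 <= C]. *)
Lemma poincare_of_linked : exists2 C : R, 1 <= C &
  forall f, measurable_fun setT f -> sqi f ->
  (\int[mu]_x f x = 0)%R -> (\int[mu]_x (f x ^+ 2)%:E <= C%:E * E f)%E.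
Proof.
have [C C0 H] := linkD.
pose m := fine (mu setT).
have mE : mu setT = m%:E by rewrite fineK// fin_num_measure.
have m0 : 0 < m by rewrite -lte_fin -mE.
exists (1 + C * (2 + m)).
  by rewrite lerDl mulr_ge0 ?addr_ge0// ltW.
move=> f mf if2 f0.
have me : measurable_fun setT (e f) by exact: measurable_energy_density.
have m0' : (0 <= m%:E)%E by rewrite lee_fin ltW.
have C0' : (0 <= C%:E)%E by rewrite lee_fin ltW.
have W0 x y : (0 <= e f x + e f y + E f)%E by apply: adde_ge0 => //; exact: adde_ge0.
have V0 x : (0 <= m%:E * e f x + E f)%E by apply: adde_ge0 => //; exact: mule_ge0.
have V0' x : (0 <= m%:E * e f x + E f + m%:E * E f)%E.
  by apply: adde_ge0 => //; exact: mule_ge0.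
have ptw x : D x -> ((m * f x ^+ 2)%:E <= C%:E * (m%:E * e f x + E f + m%:E * E f))%E.
  move=> Dx.
  have msq : measurable_fun setT (fun y => (1 * (f x - f y) ^+ 2)%:E).
    by apply/measurable_EFinP; apply: measurable_funM => //; apply: measurable_funX; exact: mB1.
  have mc a : measurable_fun setT (cst a : T -> R) by [].
  have icst a : mu.-integrable setT (EFin \o cst a) by exact: finite_measure_integrable_cst.
  have ifxy : mu.-integrable setT (fun y => ((f x - f y) ^+ 2)%:E).
    have := square_integrableD (mc (f x)) (measurable_funM (mc (-1)) mf)
      (icst (f x ^+ 2)) (square_integrableZ (-1) if2).
    by apply: eq_integrable => // y _ /=; rewrite mulN1r.
  have fxyoo : (\int[mu]_y (1 * (f x - f y) ^+ 2)%:E < +oo)%E.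
    by under eq_integral do rewrite mul1r; exact: integrable_lty.
  have m1 : (\int[mu]_y (cst 1 y)%:E <= m%:E)%E.
    by rewrite (integral_cst mu measurableT 1%E) mul1e -mE.
  have [_] := cauchy_schwarz_weight (mc 1) (mB1 x mf)
    (fun=> ler01) m0 m1 fxyoo.
  under eq_Rintegral do rewrite mul1r.
  rewrite RintegralB//; [|exact: icst|exact: square_integrableW].
  rewrite f0 subr0 Rintegral_cst// -/m => le1.
  have {}le1 : ((m * f x ^+ 2)%:E <= \int[mu]_y (1 * (f x - f y) ^+ 2)%:E)%E.
    have m'0 : (0 <= (m^-1)%:E)%E by rewrite lee_fin invr_ge0 ltW.
    have := lee_wpmul2l m'0 le1; rewrite muleA -!EFinM mulVf ?gt_eqF// mul1e.
    by apply: le_trans; rewrite lee_fin le_eqVlt; apply/orP; left; apply/eqP; field; rewrite gt_eqF.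
  apply: (le_trans le1).
  apply: (@le_trans _ _ (\int[mu]_y (C%:E * (e f x + e f y + E f)))%E).
    apply: ae_ge0_le_integral => //.
    - by move=> y _; rewrite lee_fin mul1r sqr_ge0.
    - by move=> y _; exact: mule_ge0.
    - by apply: emeasurable_funM => //; apply: emeasurable_funD => //; exact: emeasurable_funD.
    - by apply: filterS aeD => y Dy _; rewrite mul1r; exact: H.
  rewrite ge0_integralZl//; last first.
    by apply: emeasurable_funD => //; exact: emeasurable_funD.
  apply: lee_wpmul2l => //.
  rewrite ge0_integralD//; last 2 first.
  - by move=> y _; rewrite adde_ge0.
  - exact: emeasurable_funD.
  rewrite ge0_integralD// !integral_cst// -mE.
  by rewrite (muleC (e f x)) (muleC (E f)).
have Eoo := energy_lty mf if2.
have mf2 : measurable_fun setT (fun x => (f x ^+ 2)%:E).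
  by apply/measurable_EFinP; exact: measurable_funX.
have : (m%:E * \int[mu]_x (f x ^+ 2)%:E <= C%:E * (m%:E * E f + m%:E * E f + m%:E * E f * m%:E))%E.
  rewrite -ge0_integralZl//; last by move=> z _; rewrite lee_fin sqr_ge0.
  apply: (@le_trans _ _ (\int[mu]_x (C%:E * (m%:E * e f x + E f + m%:E * E f)))%E).
    apply: ae_ge0_le_integral => //.
    - by move=> y _; rewrite mule_ge0// lee_fin sqr_ge0.
    - exact: emeasurable_funM.
    - by move=> y _; exact: mule_ge0.
    - apply: emeasurable_funM => //; apply: emeasurable_funD => //.
      by apply: emeasurable_funD => //; exact: emeasurable_funM.
    - by apply: filterS aeD => z Dz _; rewrite -EFinM; exact: ptw.
  rewrite ge0_integralZl//; last first.
    apply: emeasurable_funD => //.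
    by apply: emeasurable_funD => //; exact: emeasurable_funM.
  apply: lee_wpmul2l => //.
  rewrite ge0_integralD//; last 2 first.
  - by apply: emeasurable_funD => //; exact: emeasurable_funM.
  - by move=> y _; rewrite mule_ge0.
  rewrite ge0_integralD//; last 2 first.
  - by move=> y _; rewrite mule_ge0.
  - exact: emeasurable_funM.
  rewrite ge0_integralZl// !integral_cst// -mE.
  by rewrite (muleC (E f) (mu setT)).
have Efin : E f \is a fin_num by rewrite ge0_fin_numE.
have f2fin : (\int[mu]_x (f x ^+ 2)%:E)%E \is a fin_num by exact: integrable_fin_num.
have Ef0 : 0 <= fine (E f) by rewrite fine_ge0.
rewrite -(fineK Efin) -(fineK f2fin).
move: (fine _) (fine (E f)) Ef0 => F e' e'0.
rewrite -!(EFinM m) -(EFinM (m * e') m) -!EFinD -(EFinM C) -(EFinM _ e') !lee_fin => le.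
rewrite -(ler_pM2l m0); apply: le_trans le _.
rewrite -subr_ge0 (_ : _ - _ = m * e'); last by ring.
by rewrite mulr_ge0// ltW.
Qed.

(** Zero energy makes the density vanish almost everywhere, and the link between two points of
    vanishing density has right-hand side 0. The constant is the value at one such point, which
    exists because [mu] is not the zero measure. *)
Lemma nonlocal_op_kernel f : measurable_fun setT f -> sqi f ->
  {ae mu, forall x, L f x = 0} -> exists c, {ae mu, forall x, f x = c}.
Proof.
move=> mf if2 Lf.
have Ef : E f = 0%E.
  rewrite (energyE mf if2) (_ : (\int[mu]_x _)%R = 0) ?mulr0//.
  rewrite /Rintegral (ae_eq_integral (cst 0%E)) ?integral0//.
    apply/measurable_EFinP; apply: measurable_funM => //.
    exact: measurable_nonlocal_op.
  by apply: filterS Lf => x /= -> _; rewrite mul0r.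
have me : measurable_fun setT (e f) by exact: measurable_energy_density.
have aee : {ae mu, forall x, e f x = 0%E}.
  have := ae_eq_integral_abs mu measurableT me.
  under eq_integral => x _ do rewrite gee0_abs//.
  rewrite -/(energy mu k f) Ef => -[/(_ erefl) + _].
  by apply: filterS => x /= /(_ I).
have aeDe : {ae mu, forall x, D x /\ e f x = 0%E} by exact: filterI aeD aee.
have [x0 [Dx0 ex0]] : exists x, D x /\ e f x = 0%E.
  apply: contrapT => nex.
  have : mu.-negligible setT.
    have h : mu.-negligible (~` [set x | D x /\ e f x = 0%E]) := aeDe.
    by apply: negligibleS h => x _ Dex; apply: nex; exists x.
  by move/measure_negligible => /(_ measurableT) muT0; move: muT; rewrite muT0 ltxx.
exists (f x0).
apply: filterS aeDe => x [Dx ex].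
have [C C0 H] := linkD.
have := H f mf x x0 Dx Dx0; rewrite ex ex0 Ef !adde0 mule0 lee_fin => le0.
have : (f x - f x0) ^+ 2 == 0 by rewrite eq_le le0 sqr_ge0.
by rewrite sqrf_eq0 subr_eq0 => /eqP.
Qed.

End linked_everywhere.

End nonlocal_operator.

(** * The sup norm and its comparison with the Euclidean norm *)

Fixpoint supnorm (R : realType) (n : nat) : Rn R n -> R :=
  match n return Rn R n -> R with
  | 0 => fun x => `|(x : R)|
  | S n => fun x => Num.max (supnorm x.1) `|(x.2 : R)|
  end.

(** A box is a product of intervals, so its measure follows by the same recursion as [Rn] and
    [lebn]; a Euclidean ball does not factor. *)
Definition box (R : realType) (n : nat) (p : Rn R n) (r : R) : set (Rn R n) :=
  [set x | supnorm (vsub x p) < r].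

Section supnorm.
Context (R : realType).

Lemma supnorm_ge0 n (x : Rn R n) : 0 <= supnorm x.
Proof.
by case: n x => [|n] x /=; [exact: normr_ge0|rewrite le_max normr_ge0 orbT].
Qed.

Lemma vnegB n (x y : Rn R n) : vneg (vsub x y) = vsub y x.
Proof.
elim: n x y => [|n IH] x y /=; first by rewrite opprB.
by rewrite IH opprB.
Qed.

Lemma supnormBC n (x y : Rn R n) : supnorm (vsub x y) = supnorm (vsub y x).
Proof.
elim: n x y => [|n IH] x y /=; first exact: distrC.
by congr (Num.max _ _); [exact: IH|exact: distrC].
Qed.

Lemma supnormBB n (x : Rn R n) : supnorm (vsub x x) = 0.
Proof.
have B (a : R) : `|a - a| = 0 by rewrite subrr normr0.
elim: n x => [|n IH] x /=; first exact: B.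
by rewrite IH B maxxx.
Qed.

Lemma supnorm_triangle n (y x z : Rn R n) :
  supnorm (vsub x z) <= supnorm (vsub x y) + supnorm (vsub y z).
Proof.
elim: n x y z => [|n IH] x y z /=; first exact: ler_distD.
rewrite ge_max; apply/andP; split.
  by apply: le_trans (IH x.1 y.1 z.1) _; rewrite lerD// le_max lexx.
apply: le_trans (ler_distD (y.2 : R) x.2 z.2) _.
by rewrite lerD// le_max lexx orbT.
Qed.

Lemma supnormB_le n (x y : Rn R n) : supnorm (vsub x y) <= supnorm x + supnorm y.
Proof.
elim: n x y => [|n IH] x y /=; first exact: ler_normB.
rewrite ge_max; apply/andP; split.
  by apply: le_trans (IH x.1 y.1) _; rewrite lerD// le_max lexx.
apply: le_trans (ler_normB (x.2 : R) y.2) _.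
by rewrite lerD// le_max lexx orbT.
Qed.

Lemma supnorm_sqr_le n (x : Rn R n) : supnorm x ^+ 2 <= sqnorm x.
Proof.
elim: n x => [|n IH] x /=; first by rewrite real_normK ?num_real.
have s0 : 0 <= sqnorm x.1 by apply: le_trans (IH x.1); exact: sqr_ge0.
rewrite /Num.max; case: ifPn => _.
  by rewrite real_normK ?num_real// lerDr.
by apply: le_trans (IH x.1) _; rewrite lerDl sqr_ge0.
Qed.

Lemma sqnorm_le n (x : Rn R n) : sqnorm x <= n.+1%:R * supnorm x ^+ 2.
Proof.
elim: n x => [|n IH] x /=; first by rewrite mul1r real_normK ?num_real.
set M := Num.max _ _.
have M1 : supnorm x.1 <= M by rewrite le_max lexx.
have M2 : `|(x.2 : R)| <= M by rewrite le_max lexx orbT.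
rewrite -[n.+2%:R]natr1 mulrDl mul1r lerD//.
  apply: le_trans (IH x.1) _; rewrite ler_wpM2l//.
  by rewrite ler_pXn2r// ?nnegrE ?supnorm_ge0// (le_trans _ M1)// supnorm_ge0.
rewrite -real_normK ?num_real// ler_pXn2r// ?nnegrE//.
by rewrite (le_trans _ M2).
Qed.

Lemma supnorm_le_enorm n (x : Rn R n) : supnorm x <= enorm x.
Proof.
rewrite /enorm -[leLHS]ger0_norm ?supnorm_ge0// -sqrtr_sqr.
by rewrite ler_wsqrtr// supnorm_sqr_le.
Qed.

Lemma supnorm_enorm_lt n (r : R) : 0 < r ->
  exists2 s : R, 0 < s & forall x : Rn R n, supnorm x < s -> enorm x < r.
Proof.
move=> r0; have n0 : (0 : R) < n.+1%:R by rewrite ltr0n.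
(* The sharp comparison factor is the square root of the dimension [n.+1]; the dimension itself is a
   cruder factor free of radicals. *)
exists (r / n.+1%:R); first by rewrite divr_gt0.
move=> x xs; rewrite /enorm -[ltRHS]ger0_norm ?ltW// -sqrtr_sqr ltr_sqrt ?exprn_gt0//.
apply: le_lt_trans (sqnorm_le x) _.
have : supnorm x * n.+1%:R < r by rewrite -ltr_pdivlMr.
have := supnorm_ge0 x; have : (1 : R) <= n.+1%:R by rewrite ler1n.
move: (supnorm x) (n.+1%:R) => s N N1 s0 sN.
have : (s * N) ^+ 2 < r ^+ 2 by rewrite ltr_pXn2r// nnegrE ?(ltW r0)// mulr_ge0// (le_trans _ N1).
apply: le_lt_trans; rewrite exprMn mulrC ler_wpM2l ?sqr_ge0//.
by rewrite expr2 ler_peMl// (le_trans _ N1).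
Qed.

(** Total boundedness as a finite colouring: each coordinate is coloured by the index of its cell in
    a grid of mesh [s]. With colours, representatives can later be chosen inside the domain, which
    grid centres would not guarantee. *)
Lemma supnorm_bounded_cover n (M s : R) : 0 < s ->
  exists (I : finType) (c : Rn R n -> I), forall x y,
    supnorm x <= M -> supnorm y <= M -> c x = c y -> supnorm (vsub x y) < s.
Proof.
move=> s0.
have [K [c Hc]] : exists K (c : R -> 'I_K.+1), forall x y : R,
    `|x| <= M -> `|y| <= M -> c x = c y -> `|x - y| < s.
  pose K := Num.truncn (2 * M / s).
  pose t (x : R) := Num.truncn ((x + M) / s).
  exists K, (fun x => inord (t x)) => x y xM yM /(congr1 val) /=.
  have tK (z : R) : `|z| <= M -> (t z <= K)%N /\ (t z)%:R <= (z + M) / s < (t z).+1%:R.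
    move=> zM; have /andP[z1 z2] : - M <= z <= M by rewrite -ler_norml.
    split; last by apply: truncn_itv; rewrite divr_ge0 ?(ltW s0)//; lra.
    by apply: le_truncn; rewrite ler_pM2r ?invr_gt0//; lra.
  have [xK /andP[x1 x2]] := tK _ xM; have [yK /andP[y1 y2]] := tK _ yM.
  rewrite !inordK ?ltnS// => txy; rewrite txy in x1 x2.
  have : `|(x + M) / s - (y + M) / s| < 1.
    by rewrite ltr_norml; move: x1 x2 y1 y2; rewrite -natr1; lra.
  rewrite -mulrBl normrM normfV (gtr0_norm s0) ltr_pdivrMr// mul1r.
  by rewrite opprD addrACA subrr addr0.
elim: n => [|n [I [c' Hc']]]; first by exists 'I_K.+1, c.
exists (I * 'I_K.+1)%type, (fun x => (c' x.1, c x.2)) => x y /=.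
rewrite !ge_max gt_max => /andP[? ?] /andP[? ?] [? ?].
by rewrite Hc' ?Hc.
Qed.

End supnorm.

(** * Measurability, volumes of boxes and sigma-finiteness *)

Section lebesgue_measure_Rn.
Context (R : realType).

Lemma measurable_vsub n :
  measurable_fun setT (fun p : Rn R n * Rn R n => vsub p.1 p.2).
Proof.
elim: n => [|n IH].
  apply: (@measurable_funB _ _ R setT (fun p : measurableTypeR R * measurableTypeR R => p.1 : R) (fun p => p.2 : R)).
    exact: measurable_fst.
  exact: measurable_snd.
apply: measurable_fun_pair.
  have m : measurable_fun setT (fun p : Rn R n.+1 * Rn R n.+1 => (p.1.1, p.2.1)).
    apply: measurable_fun_pair.
      exact: (measurableT_comp measurable_fst measurable_fst).
    exact: (measurableT_comp measurable_fst measurable_snd).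
  exact: (measurableT_comp IH m).
apply: (@measurable_funB _ _ R setT (fun p : Rn R n.+1 * Rn R n.+1 => p.1.2 : R) (fun p => p.2.2 : R)).
  exact: (measurableT_comp measurable_snd measurable_fst).
exact: (measurableT_comp measurable_snd measurable_snd).
Qed.

Lemma measurable_supnorm n : measurable_fun setT (@supnorm R n).
Proof.
elim: n => [|n IH]; first exact: (@normr_measurable R setT).
apply: (@measurable_maxr _ _ R setT (fun x : Rn R n.+1 => supnorm x.1) (fun x : Rn R n.+1 => `|(x.2 : R)|)).
  exact: (measurableT_comp IH measurable_fst).
exact: (measurableT_comp (@normr_measurable R setT) measurable_snd).
Qed.

Lemma measurable_vsubr n (p : Rn R n) : measurable_fun setT (fun x : Rn R n => vsub x p).
Proof.
have m : measurable_fun setT (fun x : Rn R n => (x, p)) by exact: measurable_fun_pair.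
exact: (measurableT_comp (@measurable_vsub n) m).
Qed.

Lemma measurable_box n (p : Rn R n) r : measurable (box p r).
Proof.
have m : measurable_fun setT (fun x : Rn R n => supnorm (vsub x p)).
  exact: (measurableT_comp (@measurable_supnorm n) (measurable_vsubr p)).
have := m measurableT `]-oo, r[%classic (measurable_itv _).
by rewrite setTI; congr measurable; apply/seteqP; split => x; rewrite /= in_itv.
Qed.

Lemma boxS n (p : Rn R n.+1) r : box p r = box p.1 r `*` [set x : R | `|x - p.2| < r].
Proof.
apply/seteqP; split => x; rewrite /box /= gt_max.
  by move=> /andP[].
by move=> [? ?]; apply/andP.
Qed.

Lemma lebesgue_measure_itv_center (p r : R) : 0 < r ->
  lebesgue_measure [set x : R | `|x - p| < r] = (2 * r)%:E.
Proof.
move=> r0; have -> : [set x : R | `|x - p| < r] = ball p r.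
  by apply/seteqP; split => x; rewrite /ball/= distrC.
by rewrite lebesgue_measure_ball 1?ltW// mulr_natl.
Qed.

Lemma lebn_box n (p : Rn R n) r : 0 < r -> lebn R n (box p r) = ((2 * r) ^+ n.+1)%:E.
Proof.
move=> r0; elim: n p => [|n IH] p.
  by rewrite expr1; exact: lebesgue_measure_itv_center.
rewrite boxS /= product_measure1E//.
- rewrite IH; apply: (eq_trans (congr1 _ (lebesgue_measure_itv_center (p.2 : R) r0))).
  by rewrite -EFinM -exprSr.
- exact: measurable_box.
- exact: (@measurable_box 0 (p.2 : R)).
Qed.

Lemma lebn_sigma_finite n : sigma_finite setT (lebn R n).
Proof.
pose o : Rn R n := point.
exists (fun k => box o k.+1%:R).
  apply/seteqP; split => x _ //.
  exists (Num.truncn (supnorm (vsub x o))) => //.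
  by rewrite /box/=; have /andP[] := truncn_itv (supnorm_ge0 (vsub x o)).
move=> k; split; first exact: measurable_box.
by rewrite lebn_box ?ltry.
Qed.

End lebesgue_measure_Rn.

(* [lebn] is packed as a mere measure; this copy carries the sigma-finite
   structure that Tonelli's theorem asks for. *)
Definition sfleb (R : realType) (n : nat) : set (Rn R n) -> \bar R := lebn R n.

HB.instance Definition _ (R : realType) (n : nat) :=
  Measure.copy (@sfleb R n) (lebn R n).
HB.instance Definition _ (R : realType) (n : nat) :=
  Measure_isSigmaFinite.Build _ _ _ (@sfleb R n) (@lebn_sigma_finite R n).

(** * Translation invariance of the integral *)

Section translation.
Context (R : realType).

Lemma lebesgue_integral_translate (a : R) (f : measurableTypeR R -> \bar R) :
  measurable_fun setT f -> (forall x, 0 <= f x)%E ->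
  (\int[lebesgue_measure]_x f (x - a)%R = \int[lebesgue_measure]_x f x)%E.
Proof.
move=> mf f0.
have mt : measurable_fun setT (fun x : measurableTypeR R => (x - a)%R : measurableTypeR R).
  exact: (@measurable_vsubr R 0 (a : R)).
rewrite -(@ge0_integral_pushforward _ _ _ _ _ _ mt lebesgue_measure setT f)//.
apply: eq_measure_integral => A mA _.
(* The image of Lebesgue measure under a translation is identified by its values on half-open
   intervals. *)
apply/esym/lebesgue_measure_unique => //= _ [[u v]] _ <-.
rewrite /pushforward (_ : _ @^-1` _ = `]u + a, v + a]%classic); last first.
  by apply/seteqP; split => x /=; rewrite !in_itv/= ltrBrDr lerBlDr.
rewrite !lebesgue_measure_itv/= !lte_fin ltrD2r.
by case: ifP => // _; rewrite -!EFinB opprD addrACA subrr addr0.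
Qed.

Lemma lebn_integral_translate n (a : Rn R n) (f : Rn R n -> \bar R) :
  measurable_fun setT f -> (forall x, 0 <= f x)%E ->
  (\int[lebn R n]_x f (vsub x a) = \int[lebn R n]_x f x)%E.
Proof.
elim: n a f => [|n IH] a f mf f0; first exact: lebesgue_integral_translate.
have mfa : measurable_fun setT (fun x : Rn R n.+1 => f (vsub x a)).
  exact: (measurableT_comp mf (measurable_vsubr a)).
rewrite (fubini_tonelli1 (m1 := @sfleb R n) (m2 := lebesgue_measure) _ mfa)//.
rewrite [RHS](fubini_tonelli1 (m1 := @sfleb R n) (m2 := lebesgue_measure) _ mf)//.
rewrite -[RHS](IH a.1); last 2 first.
- exact: (measurable_fun_fubini_tonelli_F _ mf f0).
- by move=> x; exact: integral_ge0.
apply: eq_integral => x _; rewrite /fubini_F/=.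
apply: (lebesgue_integral_translate _ (f := fun y => f (vsub x a.1, y))) => //.
exact: (measurableT_comp mf (measurable_pair1 _)).
Qed.

End translation.

(** * Restriction to a set of finite measure *)

Section restriction.
Context d (T : measurableType d) (R : realType) (mu : {measure set T -> \bar R}).
Variables (D : set T) (mD : measurable D) (Doo : (mu D < +oo)%E).
Local Notation muD := (mfrestr mD Doo).

Lemma ae_mfrestr (P : T -> Prop) :
  {ae muD, forall x, P x} <-> {ae mu, forall x, D x -> P x}.
Proof.
split=> [[A [mA A0 PA]]|[A [mA A0 PA]]].
  exists (A `&` D); split => //; first exact: measurableI.
  move=> x /= /not_implyP[Dx nPx]; split => //; exact: PA.
exists (A `|` ~` D); split=> //.
- by apply: measurableU => //; exact: measurableC.
- apply/eqP; rewrite -measure_le0 -A0; apply: le_measure; rewrite ?inE//.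
    apply: measurableI => //; apply: measurableU => //; exact: measurableC.
  by move=> x [[]].
- move=> x /= nPx; have [Dx|] := pselect (D x); last by right.
  by left; apply: PA => /= /(_ Dx).
Qed.

Lemma integral_mfrestr (f : T -> \bar R) : measurable_fun setT f ->
  (\int[muD]_x f x = \int[mu]_(x in D) f x)%E.
Proof.
move=> mf.
have -> : (\int[mu]_(x in D) f x = \int[muD]_(x in D) f x)%E.
  apply: eq_measure_integral => A mA AD.
  by rewrite -[in LHS](setIidl AD).
rewrite [RHS]integral_mkcond; apply: ae_eq_integral => //.
  by apply/(measurable_restrictT _ mD); exact: measurable_funTS.
apply/ae_mfrestr; apply: aeW => x Dx _.
by rewrite patchT// inE.
Qed.

Lemma integrable_mfrestr (f : T -> \bar R) : measurable_fun setT f ->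
  muD.-integrable setT f <-> mu.-integrable D f.
Proof.
move=> mf; have mf' : measurable_fun setT (abse \o f) by exact: measurableT_comp.
split=> /integrableP[_ foo]; apply/integrableP; split=> //.
- exact: measurable_funTS.
- by rewrite -(integral_mfrestr mf').
- by rewrite (integral_mfrestr mf').
Qed.

End restriction.

(** * Linking all points of a bounded connected open set *)

Section connected_domain.
Context (R : realType) (n : nat) (Omega : set (Rn R n)) (J : Rn R n -> R) (s0 : R).
Hypothesis mO : measurable Omega.
Hypothesis openO : eopen Omega.
Hypothesis connO : econnected Omega.
Hypothesis Ooo : (lebn R n Omega < +oo)%E.
Hypothesis mJ : measurable_fun setT J.
Hypothesis J0 : forall z, 0 <= J z.
Hypothesis Jsym : forall x y, J (vsub x y) = J (vsub y x).
Hypothesis J1 : (\int[lebn R n]_z (J z)%:E <= 1)%E.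
Hypothesis s00 : 0 < s0.
Hypothesis Jpos : forall z, supnorm z < s0 -> 0 < J z.

Let mu : {finite_measure set (Rn R n) -> \bar R} := mfrestr mO Ooo.
Let k x y := J (vsub x y).

Lemma measurable_translation_kernel :
  measurable_fun setT (fun p : Rn R n * Rn R n => J (vsub p.1 p.2)).
Proof. exact: (measurableT_comp mJ (@measurable_vsub R n)). Qed.

Lemma integral_kernel_le1 x : (\int[mu]_y (k x y)%:E <= 1)%E.
Proof.
have mk : measurable_fun setT (fun y => (J (vsub y x))%:E).
  by apply/measurable_EFinP; exact: (measurableT_comp mJ (measurable_vsubr x)).
under eq_integral do rewrite /k Jsym.
rewrite integral_mfrestr//.
apply: (@le_trans _ _ (\int[lebn R n]_y (J (vsub y x))%:E)%E).
  by apply: ge0_subset_integral => // y _; rewrite lee_fin.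
rewrite (lebn_integral_translate x (f := fun z => (J z)%:E))//.
exact/measurable_EFinP.
Qed.

(** A point within [2 * r] of [p] and a point within [r] of [p] are less than [3 * r = s0] apart,
    where [J] is positive. *)
Let r := s0 / 3.
Let r0 : 0 < r. Proof. by rewrite divr_gt0. Qed.

Let cell p := Omega `&` box p r.

Let mcell p : measurable (cell p).
Proof. by apply: measurableI => //; exact: measurable_box. Qed.

Let cell_gt0 p : Omega p -> (0 < lebn R n (cell p))%E.
Proof.
move=> Op; have [r1 r10 ballO] := openO Op.
have [s1 s10 sub1] := supnorm_enorm_lt n r10.
have m0 : 0 < Num.min s1 r by rewrite lt_min s10 r0.
apply: (@lt_le_trans _ _ (lebn R n (box p (Num.min s1 r)))).
  by rewrite lebn_box// lte_fin exprn_gt0// mulr_gt0.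
apply: le_measure; rewrite ?inE//; first exact: measurable_box.
move=> x; rewrite /box/= lt_min => /andP[xs xr]; split => //.
by apply: ballO; exact: sub1.
Qed.

(** The substitute for a lower bound on [J]: the sublevel sets for thresholds [j.+1%:R^-1] decrease
    to the empty set and have finite measure, so their measures tend to 0. Translation invariance
    makes the threshold independent of [x]. *)
Let small_kernel_set (eps : R) : 0 < eps -> exists2 eta : R, 0 < eta &
  forall x, (lebn R n [set z | supnorm (vsub z x) < s0 /\ J (vsub z x) < eta]%R <= eps%:E)%E.
Proof.
move=> eps0.
pose F (j : nat) : set (Rn R n) := [set v | supnorm v < s0 /\ J v < j.+1%:R^-1].
have mF j : measurable (F j).
  apply: measurableI.
    have := @measurable_supnorm R n measurableT `]-oo, s0[%classic (measurable_itv _).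
    by rewrite setTI; congr measurable; apply/seteqP; split => x; rewrite /= in_itv.
  have := mJ measurableT (measurable_itv `]-oo, (j.+1%:R^-1)[%R).
  by rewrite setTI; congr measurable; apply/seteqP; split => x; rewrite /= in_itv.
have Fx j x : lebn R n [set z | F j (vsub z x)] = lebn R n (F j).
  have mS : measurable [set z | F j (vsub z x)].
    by have := measurable_vsubr x measurableT (mF j); rewrite setTI.
  have mi : measurable_fun setT (fun z => (\1_(F j) z)%:E : \bar R).
    by apply/measurable_EFinP; exact: measurable_indic.
  have ind (A : set (Rn R n)) : measurable A ->
      (\int[lebn R n]_z (\1_A z)%:E = lebn R n A)%E.
    by move=> mA; rewrite integral_indic// setIT.
  rewrite -(ind _ mS) -(ind _ (mF j)) -(lebn_integral_translate x mi)//.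
have p0 : Rn R n by exact: point.
have F0oo : (lebn R n (F 0%N) < +oo)%E.
  rewrite -(Fx 0%N p0); apply: (@le_lt_trans _ _ (lebn R n (box p0 s0))).
    apply: le_measure; rewrite ?inE//.
    - by have := measurable_vsubr p0 measurableT (mF 0%N); rewrite setTI.
    - exact: measurable_box.
    - by move=> z [].
  by rewrite lebn_box// ltry.
have capF : \bigcap_j F j = set0.
  apply/seteqP; split => // v Fv.
  have vs : supnorm v < s0 by have [] := Fv 0%N I.
  have Jv := Jpos vs.
  (* This index has [j.+1%:R^-1 <= J v], which excludes [v] from [F j]. *)
  have [] := Fv (Num.truncn (J v)^-1) I => _.
  rewrite ltNge => /negP; apply.
  rewrite -[leRHS]invrK lef_pV2 ?posrE ?invr_gt0//.
  have Jv' : 0 <= (J v)^-1 by rewrite invr_ge0 ltW.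
  by have /andP[_ /ltW] := truncn_itv Jv'.
have ndF : {homo F : a b / (a <= b)%N >-> (b <= a)%O}.
  move=> a b ab; apply/subsetPset => v [vs Jv]; split=> //.
  by apply: lt_le_trans Jv _; rewrite lef_pV2 ?posrE ?ltr0n// ler_nat.
have := nonincreasing_cvg_mu F0oo mF _ ndF; rewrite capF measure0 => /(_ measurable0) cvgF.
have /cvgF[j _ jP] : nbhs (0%E : \bar R) [set y | (y < eps%:E)%E].
  by apply: open_ereal_lt'; rewrite lte_fin.
exists j.+1%:R^-1 => // x.
by have := jP j (leqnn j); rewrite /= -(Fx j x) => /ltW.
Qed.

Let kE x y : k x y = J (vsub y x). Proof. exact: Jsym. Qed.

(** All [z] in the cell are within range of both [x] and [y]. Each of the two sets where the kernel
    is below [eta] costs at most a quarter of the cell's measure [b], so the overlap keeps at least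
    [b / 2]. *)
Let linked_local p : Omega p ->
  linked mu k (Omega `&` box p (2 * r)) (Omega `&` box p (2 * r)).
Proof.
move=> Op; pose b := fine (lebn R n (cell p)).
have celloo : (lebn R n (cell p) < +oo)%E.
  by apply: le_lt_trans Ooo; apply: le_measure; rewrite ?inE//; exact: subIsetl.
have bE : lebn R n (cell p) = b%:E by rewrite fineK// ge0_fin_numE.
have b0 : 0 < b by rewrite -lte_fin -bE; exact: cell_gt0.
have b4 : 0 < b / 4 by rewrite divr_gt0.
have [eta eta0 small] := small_kernel_set b4.
have b2 : 0 < b / 2 by rewrite divr_gt0.
apply: (@linked_overlap _ _ _ mu k measurable_translation_kernel (fun x y => J0 _) _ eta (b / 2)) => //.
move=> x y [_ xp] [_ yp].
pose F u := [set z | supnorm (vsub z u) < s0 /\ J (vsub z u) < eta].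
have mF u : measurable (F u).
  have mv := measurable_vsubr u.
  apply: measurableI.
    exact: measurable_box.
  have := (measurableT_comp mJ mv) measurableT _ (measurable_itv `]-oo, eta[%R).
  by rewrite setTI; congr measurable; apply/seteqP; split => z; rewrite /= in_itv.
pose S := [set z | eta <= k x z /\ eta <= k y z].
have mG : measurable S.
  have mk u : measurable [set z | eta <= k u z].
    have mv := measurable_vsubr u.
    have := (measurableT_comp mJ mv) measurableT _ (measurable_itv `[eta, +oo[%R).
    rewrite setTI; congr measurable; apply/seteqP; split => z.
      by rewrite /= in_itv/= andbT kE.
    by rewrite /= in_itv/= andbT kE.
  exact: (measurableI _ _ (mk x) (mk y)).
have near_ u z : box p (2 * r) u -> box p r z -> supnorm (vsub z u) < s0.
  move=> pu pz; apply: le_lt_trans (supnorm_triangle p z u) _.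
  rewrite (supnormBC p u) (_ : s0 = r + 2 * r); last by rewrite /r; field.
  exact: ltrD.
have sub : cell p `<=` (S `&` Omega)
    `|` (F x `|` F y).
  move=> z [Oz pz].
  have [xz|xz] := leP eta (k x z); last first.
    by right; left; split; [exact: near_|rewrite -kE].
  have [yz|yz] := leP eta (k y z); last first.
    by right; right; split; [exact: near_|rewrite -kE].
  by left.
have : (lebn R n (cell p) <=
    lebn R n (S `&` Omega) + (lebn R n (F x) + lebn R n (F y)))%E.
  apply: (le_trans (le_measure _ _ _ sub)); rewrite ?inE//.
    by apply: measurableU; [exact: measurableI|exact: measurableU].
  apply: (le_trans (measureU2 _ _ _)); [exact: measurableI|exact: measurableU|].
  by apply: leeD => //; exact: measureU2.
rewrite bE => le1.
have : (b%:E <= lebn R n (S `&` Omega) + (b / 4 + b / 4)%:E)%E.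
  apply: (le_trans le1); apply: leeD => //; rewrite EFinD.
  by apply: leeD; exact: small.
rewrite -leeBlDr// -EFinB; apply: le_trans.
by rewrite lee_fin; lra.
Qed.

Let rel p q := linked mu k (cell p) (cell q).

Let box_sub (p q : Rn R n) r1 : supnorm (vsub q p) < r1 -> box q r `<=` box p (r1 + r).
Proof.
move=> qp x; rewrite /box/= => xq.
by apply: le_lt_trans (supnorm_triangle q x p) _; rewrite addrC; exact: ltrD.
Qed.

Let rel_near (p q : Rn R n) : Omega p -> supnorm (vsub q p) < r -> rel p q /\ rel q p.
Proof.
move=> Op qp.
have r2 : 2 * r = r + r by rewrite mulr_natl.
have sp : cell p `<=` Omega `&` box p (2 * r).
  by rewrite r2; apply: setIS; apply: box_sub; rewrite supnormBB.
have sq : cell q `<=` Omega `&` box p (2 * r).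
  by rewrite r2; apply: setIS; exact: box_sub.
by split; apply: (linkedS _ _ (linked_local Op)).
Qed.

Let rel_trans p q u : Omega q -> rel p q -> rel q u -> rel p u.
Proof.
move=> Oq; apply: linked_trans => //.
- exact: measurable_translation_kernel.
- by move=> ? ?; exact: J0.
- rewrite -[X in (_ < X)%E]/(lebn R n (cell q `&` Omega)) setIidl ?cell_gt0//.
  exact: subIsetl.
Qed.

(** Nearby points are related in both directions, so the points of [Omega] related to [p] and those
    not related to [p] both form open sets; connectedness leaves the second one empty. *)
Let rel_all p q : Omega p -> Omega q -> rel p q.
Proof.
move=> Op Oq.
pose A := [set u | Omega u /\ rel p u].
pose B := [set u | Omega u /\ ~ rel p u].
have nbh u : Omega u -> exists2 r1 : R, 0 < r1 &
    forall y, enorm (vsub y u) < r1 -> [/\ Omega y, rel u y & rel y u].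
  move=> Ou; have [r1 r10 ballO] := openO Ou.
  exists (Num.min r1 r); first by rewrite lt_min r10 r0.
  move=> y; rewrite lt_min => /andP[yr1 yr].
  have [] := rel_near Ou (le_lt_trans (supnorm_le_enorm _) yr).
  by split => //; exact: ballO.
have oA : eopen A.
  move=> u [Ou pu]; have [r1 r10 H] := nbh u Ou; exists r1 => // y /H[Oy uy yu].
  by split => //; exact: rel_trans uy.
have oB : eopen B.
  move=> u [Ou pu]; have [r1 r10 H] := nbh u Ou; exists r1 => // y /H[Oy uy yu].
  by split => // py; apply: pu; exact: rel_trans yu.
have OAB : Omega `<=` A `|` B.
  by move=> u Ou; have [pu|pu] := pselect (rel p u); [left|right].
have AB0 : Omega `&` A `&` B = set0.
  by apply/seteqP; split => // u [[_ [_ ?]] [_ ?]].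
have pA : A p.
  by split => //; have [] := rel_near Op (_ : supnorm (vsub p p) < r); rewrite ?supnormBB.
have [OA0|OB0] := connO oA oB OAB AB0.
  by have : (Omega `&` A) p by []; rewrite OA0.
apply: contrapT => npq.
have : (Omega `&` B) q by []; rewrite OB0; exact.
Qed.

(** The constants of [rel_all] depend on the pair of centres. One representative for each colour met
    by [Omega] leaves finitely many pairs, and every point lies in the cell of its
    representative. *)
Lemma linked_domain : ebounded Omega -> linked mu k Omega Omega.
Proof.
move=> [M OM].
have [I [c Hc]] := @supnorm_bounded_cover R n M r r0.
have close x y : Omega x -> Omega y -> c x = c y -> supnorm (vsub x y) < r.
  by move=> Ox Oy; apply: Hc; apply: le_trans (supnorm_le_enorm _) _; exact: OM.
have /choice[Cf HCf] : forall ij : I * I, exists C : R, 0 < C /\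
    forall f : Rn R n -> R, measurable_fun setT f -> forall x y, Omega x -> Omega y ->
    c x = ij.1 -> c y = ij.2 ->
    (((f x - f y) ^+ 2)%:E <= C%:E *
      (energy_density mu k f x + energy_density mu k f y + energy mu k f))%E.
  move=> [i j] /=.
  have [[p [Op pi]]|np] := pselect (exists p, Omega p /\ c p = i); last first.
    (* A colour not met by [Omega] makes the requirement vacuous; any positive constant serves. *)
    by exists 1; split => // f _ x y Ox _ xi; exfalso; apply: np; exists x.
  have [[q [Oq qj]]|nq] := pselect (exists q, Omega q /\ c q = j); last first.
    by exists 1; split => // f _ x y _ Oy _ yj; exfalso; apply: nq; exists y.
  have [C C0 H] := rel_all Op Oq.
  exists C; split => // f mf x y Ox Oy xi yj; apply: H => //; split => //.
    by apply: close => //; rewrite xi.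
  by apply: close => //; rewrite yj.
exists (1 + \sum_ij Cf ij).
  by rewrite ltr_pwDl// sumr_ge0// => ij _; apply/ltW; have [] := HCf ij.
move=> f mf x y Ox Oy.
have [_ /(_ f mf x y Ox Oy erefl erefl) H] := HCf (c x, c y).
apply: (le_trans H); apply: lee_wpmul2r.
  have e0 u : (0 <= energy_density mu k f u)%E by apply: energy_density_ge0 => ? ?; exact: J0.
  have E0 : (0 <= energy mu k f)%E by apply: energy_ge0 => ? ?; exact: J0.
  by apply: adde_ge0 => //; exact: adde_ge0.
rewrite lee_fin (bigD1 (c x, c y))//= addrCA lerDl addr_ge0// sumr_ge0// => ij _.
by apply/ltW; have [] := HCf ij.
Qed.

End connected_domain.

(** * Square integrability of the source term *)

Section source_term.
Context (R : realType) (n : nat) (J h : Rn R n -> R).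
Hypothesis mJ : measurable_fun setT J.
Hypothesis J0 : forall z, 0 <= J z.
Hypothesis J1 : (\int[lebn R n]_z (J z)%:E < +oo)%E.
Hypothesis J2 : (lebn R n).-integrable setT (fun z => (J z ^+ 2)%:E).
Hypothesis mh : measurable_fun setT h.
Hypothesis ih : (lebn R n).-integrable setT (EFin \o h).

Lemma integral_convolution (g w : Rn R n -> \bar R) :
  measurable_fun setT g -> measurable_fun setT w ->
  (forall x, 0 <= g x)%E -> (forall x, 0 <= w x)%E ->
  (\int[lebn R n]_x \int[lebn R n]_y (w y * g (vsub x y)) =
   (\int[lebn R n]_y w y) * \int[lebn R n]_x g x)%E.
Proof.
move=> mg mw g0 w0.
have mF : measurable_fun setT (fun p : Rn R n * Rn R n => w p.2 * g (vsub p.1 p.2))%E.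
  apply: emeasurable_funM.
    exact: (measurableT_comp mw measurable_snd).
  exact: (measurableT_comp mg (@measurable_vsub R n)).
rewrite (fubini_tonelli (m1 := @sfleb R n) (m2 := @sfleb R n) _ mF)/=; last first.
  by move=> p; rewrite mule_ge0.
have Ig : (0 <= \int[lebn R n]_x g x)%E by exact: integral_ge0.
rewrite -ge0_integralZr//; apply: eq_integral => y _.
rewrite ge0_integralZl//.
  by congr (_ * _)%E; exact: lebn_integral_translate.
exact: (measurableT_comp mg (measurable_vsubr y)).
Qed.

Let normh : (\int[lebn R n]_y (`|h y|)%:E < +oo)%E.
Proof. by move/integrableP : ih => []. Qed.

Let mnh : measurable_fun setT (fun y => (`|h y|)%:E).
Proof. by apply/measurable_EFinP; exact: measurableT_comp. Qed.

Let mJh : measurable_fun setT (fun p : Rn R n * Rn R n => (J (vsub p.1 p.2) * h p.2)%:E).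
Proof.
apply/measurable_EFinP; apply: measurable_funM.
  exact: (measurableT_comp mJ (@measurable_vsub R n)).
exact: (measurableT_comp mh measurable_snd).
Qed.

Let iJh : (@sfleb R n \x @sfleb R n)%E.-integrable setT
  (fun p : Rn R n * Rn R n => (J (vsub p.1 p.2) * h p.2)%:E).
Proof.
apply/(integrable12ltyP _ _ mJh).
rewrite [ltLHS](_ : _ = (\int[lebn R n]_x \int[lebn R n]_y ((`|h y|)%:E * (J (vsub x y))%:E))%E).
  rewrite (integral_convolution (g := fun z => (J z)%:E) _ mnh)//.
  - by apply: lte_mul_pinfty => //; [exact: integral_ge0|rewrite ge0_fin_numE//; exact: integral_ge0].
  - exact/measurable_EFinP.
apply: eq_integral => x _; apply: eq_integral => y _.
by rewrite /= normrM (ger0_norm (J0 _)) mulrC.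
Qed.

Definition source x : R := (\int[lebn R n]_y (J (vsub x y) * h y))%R.

Lemma measurable_source : measurable_fun setT source.
Proof.
by apply: measurableT_comp => //; exact: (measurable_fubini_F iJh).
Qed.

Lemma measurable_source_ereal :
  measurable_fun setT (fun x => \int[lebn R n]_y (J (vsub x y) * h y)%:E)%E.
Proof. exact: (measurable_fubini_F iJh). Qed.

Lemma ae_source_integrable : {ae lebn R n, forall x,
  (lebn R n).-integrable setT (fun y => (J (vsub x y) * h y)%:E)}.
Proof. exact: (ae_integrable1 iJh). Qed.

(** Young's inequality for an [L^1] function against an [L^2] kernel: Cauchy-Schwarz with weight
    [|h|] bounds the squared source by [c] times the convolution of [|h|] with [J ^+ 2], which
    Tonelli integrates. *)
Lemma source_square_integrable :
  (lebn R n).-integrable setT (fun x => (source x ^+ 2)%:E).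
Proof.
pose S x := (\int[lebn R n]_y (`|h y| * J (vsub x y) ^+ 2)%:E)%E.
have mJ2 : measurable_fun setT (fun z => (J z ^+ 2)%:E).
  by apply/measurable_EFinP; exact: measurable_funX.
have S0 x : (0 <= S x)%E.
  by apply: integral_ge0 => y _; rewrite lee_fin mulr_ge0// sqr_ge0.
have mS : measurable_fun setT S.
  apply: (measurable_fun_fubini_tonelli_F (m2 := @sfleb R n)
    (fun p : Rn R n * Rn R n => (`|h p.2| * J (vsub p.1 p.2) ^+ 2)%:E)).
    apply/measurable_EFinP; apply: measurable_funM.
      by apply: measurableT_comp => //; exact: (measurableT_comp mh measurable_snd).
    apply: measurable_funX; exact: (measurableT_comp mJ (@measurable_vsub R n)).
  by move=> p; rewrite lee_fin mulr_ge0// sqr_ge0.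
have Soo : (\int[lebn R n]_x S x < +oo)%E.
  rewrite [ltLHS](_ : _ = (\int[lebn R n]_x \int[lebn R n]_y ((`|h y|)%:E * (J (vsub x y) ^+ 2)%:E))%E).
    rewrite (integral_convolution (g := fun z => (J z ^+ 2)%:E) mJ2 mnh)//.
      apply: lte_mul_pinfty => //; [exact: integral_ge0|rewrite ge0_fin_numE//; exact: integral_ge0|].
      exact: integrable_lty.
    by move=> z; rewrite lee_fin sqr_ge0.
  by apply: eq_integral => x _; apply: eq_integral => y _; rewrite EFinM.
(* Adding 1 keeps [c] positive when [h] vanishes almost everywhere. *)
pose c := 1 + fine (\int[lebn R n]_y (`|h y|)%:E)%E.
have nh0 : (0 <= \int[lebn R n]_y (`|h y|)%:E)%E by exact: integral_ge0.
have c0 : 0 < c by rewrite ltr_pwDl// fine_ge0.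
have hc : (\int[lebn R n]_y (`|h y|)%:E <= c%:E)%E.
  by rewrite /c EFinD fineK ?ge0_fin_numE// leeDr.
have Fle x : ((source x ^+ 2)%:E <= c%:E * S x)%E.
  have [Sx|] := ltP (S x) +oo%E; last first.
    by rewrite leye_eq => /eqP ->; rewrite gt0_muley ?leey// lte_fin.
  have mJx : measurable_fun setT (fun y => J (vsub x y)).
    exact: (measurableT_comp (measurableT_comp mJ (@measurable_vsub R n)) (measurable_pair1 x)).
  have mnh' : measurable_fun setT (fun y => `|h y|) by exact: measurableT_comp.
  have [i1] := cauchy_schwarz_weight mnh' mJx (fun y => normr_ge0 (h y)) c0 hc Sx.
  apply: le_trans; rewrite lee_fin.
  have i2 : (lebn R n).-integrable setT (EFin \o (fun y => J (vsub x y) * h y)).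
    apply: (le_integrable measurableT _ _ i1).
      by apply/measurable_EFinP; exact: measurable_funM.
    by move=> y _; rewrite /= lee_fin !normrM normr_id mulrC.
  rewrite -[leLHS]real_normK ?num_real// ler_pXn2r ?nnegrE//; last first.
    by apply: Rintegral_ge0 => y _; rewrite mulr_ge0.
  apply: (le_trans (le_normr_Rintegral measurableT i2)).
  rewrite le_eqVlt; apply/orP; left; apply/eqP; apply: eq_Rintegral => y _.
  by rewrite normrM (ger0_norm (J0 _)) mulrC.
apply: integrable_ge0.
- by apply: measurable_funX; exact: measurable_source.
- by move=> x; exact: sqr_ge0.
apply: (@le_lt_trans _ _ (\int[lebn R n]_x (c%:E * S x))%E).
  apply: ge0_le_integral => //.
  - by move=> x _; rewrite lee_fin sqr_ge0.
  - by apply/measurable_EFinP; apply: measurable_funX; exact: measurable_source.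
  - exact: emeasurable_funM.
rewrite ge0_integralZl//; last by rewrite lee_fin ltW.
by rewrite lte_mul_pinfty// lee_fin ltW.
Qed.

End source_term.

(** * The stationary equation as an equation for the operator on [Omega] *)

Section stationary_problem.
Context (R : realType) (n : nat) (Omega : set (Rn R n)) (J h : Rn R n -> R) (d : R).
Hypothesis mO : measurable Omega.
Hypothesis openO : eopen Omega.
Hypothesis boundO : ebounded Omega.
Hypothesis connO : econnected Omega.
Hypothesis O0 : Omega !=set0.
Hypothesis KJ : kernel_assumptions J d.
Hypothesis J2 : (lebn R n).-integrable setT (fun z => (J z ^+ 2)%:E).
Hypothesis ih : (lebn R n).-integrable (~` Omega) (fun y => (h y)%:E).

Let mJ : measurable_fun setT J. Proof. by have [[]] := KJ. Qed.
Let J0 z : 0 <= J z. Proof. by have [[_ _ ? _]] := KJ. Qed.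
Let Jsym x y : J (vsub x y) = J (vsub y x).
Proof. by have [[_ _ _ Jn] _] := KJ; rewrite -(Jn (vsub x y)) vnegB. Qed.
Let J1 : (\int[lebn R n]_z (J z)%:E = 1)%E. Proof. by have [_ []] := KJ. Qed.

Let mOc : measurable (~` Omega). Proof. exact: measurableC. Qed.

Let Ooo : (lebn R n Omega < +oo)%E.
Proof.
have [p Op] := O0; have [M OM] := boundO.
have M0 : 0 <= M by apply: le_trans (OM _ Op); exact: sqrtr_ge0.
have r0 : 0 < 2 * M + 1 by rewrite ltr_wpDl// mulr_ge0.
apply: (@le_lt_trans _ _ (lebn R n (box p (2 * M + 1)))).
  apply: le_measure; rewrite ?inE//; first exact: measurable_box.
  move=> x Ox; rewrite /box/=; apply: (@le_lt_trans _ _ (2 * M)); last by rewrite ltrDl.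
  have xM := le_trans (supnorm_le_enorm x) (OM _ Ox).
  have pM := le_trans (supnorm_le_enorm p) (OM _ Op).
  by apply: le_trans (supnormB_le x p) _; rewrite mulr_natl mulr2n lerD.
by rewrite lebn_box// ltry.
Qed.

Let mu : {finite_measure set (Rn R n) -> \bar R} := mfrestr mO Ooo.
Let k x y := J (vsub x y).

Let mk : measurable_fun setT (fun p : Rn R n * Rn R n => k p.1 p.2).
Proof. exact: (measurable_translation_kernel mJ). Qed.

Let k0 x y : 0 <= k x y. Proof. exact: J0. Qed.
Let ksym x y : k x y = k y x. Proof. exact: Jsym. Qed.
Let k1 x : (\int[mu]_y (k x y)%:E <= 1)%E.
Proof. by apply: integral_kernel_le1 => //; rewrite J1. Qed.

Let linkO : linked mu k Omega Omega.
Proof.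
have [[d0 _ _ _] [_ Jpos _]] := KJ.
have [s s0 Hs] := supnorm_enorm_lt n d0.
by apply: (@linked_domain R n Omega J s) => // z /Hs; exact: Jpos.
Qed.

Let muT : (0 < mu setT)%E.
Proof.
rewrite -[X in (_ < X)%E]/(lebn R n (setT `&` Omega)) setTI.
have [p Op] := O0; have [r r0 ballO] := openO Op.
have [s s0 sub] := supnorm_enorm_lt n r0.
apply: (@lt_le_trans _ _ (lebn R n (box p s))).
  by rewrite lebn_box// lte_fin exprn_gt0// mulr_gt0.
apply: le_measure; rewrite ?inE//; first exact: measurable_box.
by move=> x xs; apply: ballO; exact: sub.
Qed.

Let aeO : {ae mu, forall x, Omega x}.
Proof. by apply/ae_mfrestr; exact: aeW. Qed.

(** [h] is measurable only outside [Omega]; extension by 0 gives a function on the whole space to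
    convolve with [J]. *)
Let h' := h \_ (~` Omega).

Let mh' : measurable_fun setT h'.
Proof. by apply/(measurable_restrictT _ mOc)/measurable_EFinP; exact: measurable_int ih. Qed.

Let ih' : (lebn R n).-integrable setT (EFin \o h').
Proof. by rewrite /h' -restrict_EFin; apply/(integrable_mkcond _ mOc). Qed.

Let Hs := source J h'.

Let restrict_source x : (fun y => (J (vsub x y) * h y)%:E) \_ (~` Omega) =
  (fun y => (J (vsub x y) * h' y)%:E).
Proof. by apply/funext => y; rewrite /h' !patchE; case: ifP => _ //; rewrite mulr0. Qed.

Let ae_source : {ae lebn R n, forall x,
  (lebn R n).-integrable (~` Omega) (fun y => (J (vsub x y) * h y)%:E) /\
  (\int[lebn R n]_(y in ~` Omega) (J (vsub x y) * h y)%:E = (Hs x)%:E)%E}.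
Proof.
have J1oo : (\int[lebn R n]_z (J z)%:E < +oo)%E by rewrite J1 ltry.
apply: filterS (ae_source_integrable mJ J0 J1oo mh' ih') => x ix; split.
  by apply/(integrable_mkcond _ mOc); rewrite restrict_source.
by rewrite integral_mkcond restrict_source /Hs /source fineK//; exact: integrable_fin_num.
Qed.

Let mHs : measurable_fun setT Hs.
Proof. by apply: measurable_source => //; rewrite J1 ltry. Qed.

Let Hs2 : mu.-integrable setT (fun x => (Hs x ^+ 2)%:E).
Proof.
have mHs2 : measurable_fun setT (fun x => (Hs x ^+ 2)%:E).
  by apply/measurable_EFinP; exact: measurable_funX.
apply/(integrable_mfrestr mO Ooo mHs2).
apply: (@integrableS _ _ _ _ setT) => //.
by apply: source_square_integrable => //; rewrite J1 ltry.
Qed.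

Let integral_source :
  (\int[lebn R n]_(x in Omega)
     (\int[lebn R n]_(y in ~` Omega) (J (vsub x y) * h y)%:E) =
   (\int[mu]_x Hs x)%R%:E)%E.
Proof.
have mHsE : measurable_fun setT (fun x => (Hs x)%:E) by exact/measurable_EFinP.
rewrite fineK; last first.
  by apply: integrable_fin_num => //; exact: square_integrableW.
rewrite (integral_mfrestr mO Ooo mHsE).
apply: ae_eq_integral => //.
- have mF : measurable_fun setT (fun x => \int[lebn R n]_y (J (vsub x y) * h' y)%:E)%E.
    have J1oo : (\int[lebn R n]_z (J z)%:E < +oo)%E by rewrite J1 ltry.
    exact: measurable_source_ereal.
  apply: measurable_funTS; move: mF; congr measurable_fun.
  by apply/funext => x; rewrite -restrict_source -integral_mkcond.
- exact: measurable_funTS.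
- by apply: filterS ae_source => x [_ ->].
Qed.

Local Notation L := (nonlocal_op mu k).

Let nonlocal_op_integrableP (phi : Rn R n -> R) x : measurable_fun setT phi ->
  mu.-integrable setT (EFin \o (fun y => k x y * (phi x - phi y))) <->
  (lebn R n).-integrable Omega (fun y => (J (vsub x y) * (phi y - phi x))%:E).
Proof.
move=> mphi.
have mf : measurable_fun setT (EFin \o (fun y => k x y * (phi x - phi y))).
  apply/measurable_EFinP; apply: measurable_funM; last exact: measurable_funB.
  exact: (measurableT_comp mk (measurable_pair1 x)).
rewrite (integrable_mfrestr mO Ooo mf).
split => /(integrableZl mO (-1)); apply: eq_integrable => // y _;
  by rewrite /k /= -EFinM; congr EFin; ring.
Qed.

Let integral_nonlocal_opE (phi : Rn R n -> R) x : measurable_fun setT phi ->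
  (lebn R n).-integrable Omega (fun y => (J (vsub x y) * (phi y - phi x))%:E) ->
  (\int[lebn R n]_(y in Omega) (J (vsub x y) * (phi y - phi x))%:E = (- L phi x)%:E)%E.
Proof.
move=> mphi i1.
have mf : measurable_fun setT (EFin \o (fun y => k x y * (phi x - phi y))).
  apply/measurable_EFinP; apply: measurable_funM; last exact: measurable_funB.
  exact: (measurableT_comp mk (measurable_pair1 x)).
have iL := (nonlocal_op_integrableP x mphi).2 i1.
rewrite EFinN /nonlocal_op fineK; last exact: integrable_fin_num.
rewrite (integral_mfrestr mO Ooo mf) -mulN1e -(integralZl mO); last first.
  exact: (integrable_mfrestr mO Ooo mf).1.
by apply: eq_integral => y _; rewrite /k /= -EFinM; congr EFin; ring.
Qed.

(** A solution is constrained only on [Omega], measurability included, so it is first extended by 0.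
    With the sign of [L] the stationary equation becomes [L phi = Hs]. *)
Let solution_restrict phi : stationary_solution J Omega h phi ->
  [/\ measurable_fun setT (phi \_ Omega),
      mu.-integrable setT (fun x => ((phi \_ Omega) x ^+ 2)%:E) &
      {ae mu, forall x, L (phi \_ Omega) x = Hs x}].
Proof.
move=> [mphi iphi aephi].
have mphi' : measurable_fun setT (phi \_ Omega) by apply/(measurable_restrictT _ mO).
have phiE x : Omega x -> (phi \_ Omega) x = phi x by move=> Ox; rewrite patchT// inE.
split => //.
  apply/(integrable_mfrestr mO Ooo).
    by apply/measurable_EFinP; exact: measurable_funX.
  by apply: eq_integrable iphi => // x; rewrite inE => Ox; rewrite phiE.
apply/ae_mfrestr.
apply: filterS2 aephi ae_source => x sol [_ srcE] Ox.
have [i1 _] := sol Ox; rewrite srcE.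
have fE y : y \in Omega -> (J (vsub x y) * (phi y - phi x))%:E =
    (J (vsub x y) * ((phi \_ Omega) y - (phi \_ Omega) x))%:E.
  by rewrite inE => Oy; rewrite !phiE.
rewrite (eq_integral _ _ fE) integral_nonlocal_opE//; last by apply: eq_integrable i1.
by rewrite -EFinD => -[] /eqP; rewrite addrC subr_eq0 => /eqP.
Qed.

Let solution_of (phi : Rn R n -> R) : measurable_fun setT phi ->
  mu.-integrable setT (fun x => (phi x ^+ 2)%:E) ->
  {ae mu, forall x, [/\ mu.-integrable setT (EFin \o (fun y => k x y * (phi x - phi y)))
      & L phi x = Hs x]} ->
  stationary_solution J Omega h phi.
Proof.
move=> mphi iphi /ae_mfrestr aephi; split.
- exact: measurable_funTS.
- apply/(integrable_mfrestr mO Ooo) => //.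
  by apply/measurable_EFinP; exact: measurable_funX.
apply: filterS2 aephi ae_source => x sol [isrc srcE] Ox.
have [/(nonlocal_op_integrableP x mphi) i1 Lx] := sol Ox.
by split => //; rewrite srcE integral_nonlocal_opE// -EFinD Lx addNr.
Qed.

Lemma stationary_solvable_iff :
  (exists phi, stationary_solution J Omega h phi) <->
  (\int[lebn R n]_(x in Omega)
     (\int[lebn R n]_(y in ~` Omega) (J (vsub x y) * h y)%:E) = 0)%E.
Proof.
rewrite integral_source; split.
  move=> [phi /solution_restrict[mphi iphi Lphi]].
  suff -> : (\int[mu]_x Hs x)%R = 0 by [].
  rewrite -(integral_nonlocal_op mk k0 ksym k1 mphi iphi).
  rewrite /Rintegral; congr fine; apply: ae_eq_integral => //.
  - exact/measurable_EFinP.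
  - apply/measurable_EFinP; exact: (measurable_nonlocal_op mk k0 ksym k1).
  - by apply: filterS Lphi => x -> _.
move=> [Hs0].
have [C C1 poinc] := poincare_of_linked mk k0 ksym k1 aeO muT linkO.
have [phi [mphi iphi Lphi]] := nonlocal_equation_solvable mk k0 ksym k1 C1 poinc mHs Hs2 Hs0.
by exists phi; exact: solution_of.
Qed.

Lemma stationary_unique (phi1 phi2 : Rn R n -> R) :
  stationary_solution J Omega h phi1 -> stationary_solution J Omega h phi2 ->
  exists c : R, {ae lebn R n, forall x, Omega x -> phi1 x = phi2 x + c}.
Proof.
move=> /solution_restrict[m1 i1 L1] /solution_restrict[m2 i2 L2].
set f1 := phi1 \_ Omega in m1 i1 L1; set f2 := phi2 \_ Omega in m2 i2 L2.
pose w x := f1 x + (-1) * f2 x.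
have m2' : measurable_fun setT (fun x => (-1) * f2 x) by exact: measurable_funM.
have mw : measurable_fun setT w by exact: measurable_funD.
have iw : mu.-integrable setT (fun x => (w x ^+ 2)%:E).
  by apply: square_integrableD => //; exact: square_integrableZ.
(* Finite energy densities make both integrands integrable at almost every [x], as linearity of the
   real-valued integral requires. *)
have ae1 := ae_energy_density_lty mk k0 m1 (energy_lty mk k0 ksym k1 m1 i1).
have ae2 := ae_energy_density_lty mk k0 m2 (energy_lty mk k0 ksym k1 m2 i2).
have Lw : {ae mu, forall x, L w x = 0}.
  apply: filterS2 (filterI ae1 ae2) (filterI L1 L2) => x [e1 e2] [l1 l2].
  have j1 := nonlocal_op_integrable mk k0 k1 m1 e1.
  have j2 := nonlocal_op_integrable mk k0 k1 m2 e2.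
  rewrite /nonlocal_op.
  under eq_Rintegral => y _.
    rewrite (_ : _ * _ = k x y * (f1 x - f1 y) - k x y * (f2 x - f2 y)); last first.
      by rewrite /w; ring.
    over.
  by rewrite RintegralB// -/(L f1 x) -/(L f2 x) l1 l2 subrr.
have [c /ae_mfrestr wc] := nonlocal_op_kernel mk k0 ksym k1 aeO muT linkO mw iw Lw.
exists c; apply: filterS wc => x wx Ox; rewrite -(wx Ox) /w /f1 /f2 !patchT ?inE//.
by ring.
Qed.

End stationary_problem.

(* N = n.+1 ; R^N is  Rn R n  with Lebesgue measure  lebn R n *)
Theorem theorem3p1 (R : realType) (n : nat) (Omega : set (Rn R n))
    (J : Rn R n -> R) (d : R) (h : Rn R n -> R) :
  measurable Omega -> eopen Omega -> ebounded Omega -> econnected Omega ->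
  Omega !=set0 ->
  kernel_assumptions J d ->
  (lebn R n).-integrable setT (fun z => (J z ^+ 2)%:E) ->
  (lebn R n).-integrable (~` Omega) (fun y => (h y)%:E) ->
  ((exists phi : Rn R n -> R, stationary_solution J Omega h phi) <->
   (\int[lebn R n]_(x in Omega)
       (\int[lebn R n]_(y in ~` Omega) (J (vsub x y) * h y)%:E) = 0)%E)
  /\
  (forall phi1 phi2 : Rn R n -> R,
     stationary_solution J Omega h phi1 -> stationary_solution J Omega h phi2 ->
     exists c : R, {ae lebn R n, forall x, Omega x -> phi1 x = phi2 x + c}).
Proof.
move=> mO openO boundO connO O0 KJ J2 ih; split.
  exact: (stationary_solvable_iff mO openO boundO connO O0 KJ).
exact: (stationary_unique mO openO boundO connO O0 KJ).
Qed.
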